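(* The category $\mathbf{2TermZ}_\infty$ of 2-term $Z_\infty$-algebras and $Z_\infty$-homomorphisms and the category $\mathbf{Z2Alg}$ of Zinbiel 2-algebras and Zinbiel 2-algebra homomorphisms are equivalent.
   Context: All vector spaces are over a fixed field $K$. **2-vector spaces.** A 2-vector space is a category internal to vector spaces: a category $\mathcal{V}$ with a vector space of objects $\mathcal{V}_0$ and a vector space of morphisms $\mathcal{V}_1$ such that source $s$, target $t$, identity-assigning map $i$ (with $i(x)=1_x$) and composition $\mathcal{V}_1\times_{\mathcal{V}_0}\mathcal{V}_1\to\mathcal{V}_1$ are linear. A functor between 2-vector spaces means a pair of linear maps (on objects and on morphisms) forming a functor. A bilinear functor $\mathcal{Z}\times\mathcal{Z}\to\mathcal{Z}$ is a functor that is bilinear on objects and on morphisms. Sums of morphisms are taken in the vector space of morphisms. Below $g\circ f$ denotes first $f$, then $g$; for an object $x$ and a morphism $f$, $x\cdot f$ means $1_x\cdot f$ and $f\cdot x$ means $f\cdot 1_x$. **Zinbiel 2-algebras.** A Zinbiel 2-algebra is a 2-vector space $\mathcal{Z}$ with a bilinear functor $\cdot:\mathcal{Z}\times\mathcal{Z}\to\mathcal{Z}$ and a trilinear natural isomorphism (the Zinbielator) $$J_{x,y,z}:(x\cdot y)\cdot z\to x\cdot(y\cdot z)+x\cdot(z\cdot y)$$ such that for all objects $x,y,z,t$ $$\big(x\cdot J_{y,z,t}+x\cdot J_{z,y,t}+1+1\big)\circ\big(J_{x,y\cdot z,t}+J_{x,z\cdot y,t}\big)\circ\big(J_{x,y,z}\cdot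 t\big)=\big(1+1+x\cdot J_{z,t,y}+x\cdot J_{t,z,y}\big)\circ\big(J_{x,y,z\cdot t}+J_{x,y,t\cdot z}\big)\circ J_{x\cdot y,z,t},$$ as morphisms from $((x\cdot y)\cdot z)\cdot t$ to $x\cdot(y\cdot(z\cdot t))+x\cdot(y\cdot(t\cdot z))+x\cdot(z\cdot(y\cdot t))+x\cdot(z\cdot(t\cdot y))+x\cdot(t\cdot(y\cdot z))+x\cdot(t\cdot(z\cdot y))$. Here each $1$ is the identity morphism of the corresponding summand: on the left-hand side $1+1=1_{x\cdot(t\cdot(y\cdot z))}+1_{x\cdot(t\cdot(z\cdot y))}$, and on the right-hand side $1+1=1_{x\cdot(y\cdot(z\cdot t))}+1_{x\cdot(y\cdot(t\cdot z))}$. **Homomorphisms of Zinbiel 2-algebras.** A homomorphism $F:\mathcal{Z}\to\mathcal{Z}'$ consists of a (linear) functor $(F_0,F_1)$ between the underlying 2-vector spaces and a bilinear natural transformation $F_2(x,y):F_0(x)\cdot'F_0(y)\to F_0(x\cdot y)$ such that for all objects $x,y,z$ $$F_1(J_{x,y,z})\circ F_2(x\cdot y,z)\circ\big(F_2(x,y)\cdot'F_0(z)\big)=\big(F_2(x,y\cdot z)+F_2(x,z\cdot y)\big)\circ\big(F_0(x)\cdot'F_2(y,z)+F_0(x)\cdot'F_2(z,y)\big)\circ J'_{F_0(x),F_0(y),F_0(z)}.$$ The identity homomorphism has the identity functor and identity natural transformation. The composite of $F:\mathcal{Z}\to\mathcal{Z}'$ and $G:\mathcal{Z}'\to\mathcal{Z}''$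 has underlying functor $(G_0F_0,G_1F_1)$ and $(G\circ F)_2(x,y)=G_1(F_2(x,y))\circ G_2(F_0(x),F_0(y))$. **2-term $Z_\infty$-algebras.** A 2-term $Z_\infty$-algebra consists of vector spaces $\mathcal{V}_0,\mathcal{V}_1$, a linear map $d=l_1:\mathcal{V}_1\to\mathcal{V}_0$, bilinear maps $l_2:\mathcal{V}_i\times\mathcal{V}_j\to\mathcal{V}_{i+j}$ for $0\le i+j\le1$ (with $l_2(h,k)=0$ for $h,k\in\mathcal{V}_1$), and a trilinear map $l_3:\mathcal{V}_0\times\mathcal{V}_0\times\mathcal{V}_0\to\mathcal{V}_1$, such that for all $x,y,z,t\in\mathcal{V}_0$ and $h,k\in\mathcal{V}_1$: - $d\,l_2(x,h)=l_2(x,dh)$, $\ d\,l_2(h,x)=l_2(dh,x)$, $\ l_2(dh,k)=l_2(h,dk)$; - $d\,l_3(x,y,z)=l_2(x,l_2(y,z))+l_2(x,l_2(z,y))-l_2(l_2(x,y),z)$; - $l_3(x,y,dh)=l_2(x,l_2(y,h))+l_2(x,l_2(h,y))-l_2(l_2(x,y),h)$; - $l_3(x,dh,z)=l_2(x,l_2(h,z))+l_2(x,l_2(z,h))-l_2(l_2(x,h),z)$; - $l_3(dh,y,z)=l_2(h,l_2(y,z))+l_2(h,l_2(z,y))-l_2(l_2(h,y),z)$; - $l_2(x,l_3(y,z,t))+l_2(x,l_3(z,y,t))+l_3(x,l_2(y,z)+l_2(z,y),t)+l_2(l_3(x,y,z),t)-l_2(x,l_3(z,t,y))-l_2(x,l_3(t,z,y))-l_3(x,y,l_2(z,t)+l_2(t,z))-l_3(l_2(x,y),z,t)=0$.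 **$Z_\infty$-homomorphisms.** A $Z_\infty$-homomorphism $f:(\mathcal{V};d,l_2,l_3)\to(\mathcal{V}';d',l_2',l_3')$ consists of linear maps $f_0:\mathcal{V}_0\to\mathcal{V}_0'$, $f_1:\mathcal{V}_1\to\mathcal{V}_1'$ and a bilinear map $f_2:\mathcal{V}_0\times\mathcal{V}_0\to\mathcal{V}_1'$ such that for all $x,y,z\in\mathcal{V}_0$, $a\in\mathcal{V}_1$: - $f_0d=d'f_1$; - $f_0l_2(x,y)-l_2'(f_0(x),f_0(y))=d'f_2(x,y)$; - $f_1l_2(x,a)-l_2'(f_0(x),f_1(a))=f_2(x,da)$ and $f_1l_2(a,x)-l_2'(f_1(a),f_0(x))=f_2(da,x)$; - $f_1(l_3(x,y,z))-l_3'(f_0(x),f_0(y),f_0(z))=f_2(x,l_2(y,z)+l_2(z,y))-f_2(l_2(x,y),z)+l_2'(f_0(x),f_2(y,z)+f_2(z,y))-l_2'(f_2(x,y),f_0(z))$. The identity is $(\mathrm{id},\mathrm{id},0)$. The composite of $f:\mathcal{V}\to\mathcal{V}'$ and $g:\mathcal{V}'\to\mathcal{V}''$ is given by $(g\cdot f)_0=g_0f_0$, $(g\cdot f)_1=g_1f_1$, $(g\cdot f)_2(x,y)=g_2(f_0(x),f_0(y))+g_1(f_2(x,y))$. *)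

(* Defs.v *)
From HB Require Import structures.
From mathcomp Require Import all_boot all_order all_algebra.
From mathcomp Require Import boolp.

Set Implicit Arguments.
Unset Strict Implicit.
Unset Printing Implicit Defensive.

Import GRing.Theory.
Local Open Scope ring_scope.

Record category := Category {
  obj :> Type;
  hom : obj -> obj -> Type;
  catid : forall A, hom A A;
  catcomp : forall A B C, hom B C -> hom A B -> hom A C;
  catcomp1f : forall A B (f : hom A B), catcomp (catid B) f = f;
  catcompf1 : forall A B (f : hom A B), catcomp f (catid A) = f;
  catcompA : forall A B C D (h : hom C D) (g : hom B C) (f : hom A B),
    catcomp h (catcomp g f) = catcomp (catcomp h g) f }.

Arguments catid {c} A.

Record functor (C D : category) := Functor {
  fobj :> C -> D;
  fhom : forall A B : C, hom A B -> hom (fobj A) (fobj B);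
  fhom_id : forall A : C, fhom (catid A) = catid (fobj A);
  fhom_comp : forall (A B E : C) (g : hom B E) (f : hom A B),
    fhom (catcomp g f) = catcomp (fhom g) (fhom f) }.

Arguments fhom {C D} _ {A B} _.

Definition functor_id (C : category) : functor C C :=
  @Functor C C id (fun _ _ f => f) (fun _ => erefl) (fun _ _ _ _ _ => erefl).

Section FunctorComp.
Variables (C D E : category) (G : functor D E) (F : functor C D).

Fact functor_comp_id (A : C) : fhom G (fhom F (catid A)) = catid (G (F A)).
Proof. by rewrite !fhom_id. Qed.

Fact functor_comp_comp (A B X : C) (g : hom B X) (f : hom A B) :
  fhom G (fhom F (catcomp g f)) =
  catcomp (fhom G (fhom F g)) (fhom G (fhom F f)).
Proof. by rewrite !fhom_comp. Qed.

Definition functor_comp : functor C E :=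
  @Functor C E (fun A => G (F A)) (fun _ _ f => fhom G (fhom F f))
    functor_comp_id functor_comp_comp.
End FunctorComp.

Definition natural (C D : category) (F G : functor C D)
    (a : forall A, hom (F A) (G A)) : Prop :=
  forall (A B : C) (f : hom A B),
    catcomp (a B) (fhom F f) = catcomp (fhom G f) (a A).

Definition cat_iso (C : category) (A B : C) (f : hom A B) : Prop :=
  exists g : hom B A, catcomp g f = catid A /\ catcomp f g = catid B.

Definition naturally_isomorphic (C D : category) (F G : functor C D) : Prop :=
  exists a : forall A, hom (F A) (G A), natural a /\ forall A, cat_iso (a A).

Definition equivalent_categories (C D : category) : Prop :=
  exists (F : functor C D) (G : functor D C),
    naturally_isomorphic (functor_id C) (functor_comp G F) /\
    naturally_isomorphic (functor_comp F G) (functor_id D).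

(* The tactic [zmod] proves identities of abelian groups by normalization. *)
Module ZmodNorm.
Inductive exp := Var of nat | Zero | Add of exp & exp | Opp of exp.

Fixpoint eval (V : zmodType) (e : seq V) (a : exp) : V :=
  match a with
  | Var i => e`_i
  | Zero => 0
  | Add b c => eval e b + eval e c
  | Opp b => - eval e b
  end.

Fixpoint coef (a : exp) (i : nat) : int :=
  match a with
  | Var j => (i == j)%:Z
  | Zero => 0
  | Add b c => coef b i + coef c i
  | Opp b => - coef b i
  end.

Lemma evalE (V : zmodType) (e : seq V) a :
  eval e a = \sum_(i < size e) e`_i *~ coef a i.
Proof.
elim: a => [j||b IHb c IHc|b IHb] /=.
- have [lt_j|le_j] := ltnP j (size e).
    rewrite (bigD1 (Ordinal lt_j)) //= eqxx big1 ?addr0 // => i.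
    by rewrite -val_eqE /= => /negPf->.
  rewrite nth_default // big1 // => i _.
  by rewrite ltn_eqF ?(leq_trans (ltn_ord i)).
- by rewrite big1 // => i _; rewrite mulr0z.
- by rewrite IHb IHc -big_split; apply: eq_bigr => i _; rewrite mulrzDr.
- by rewrite IHb -sumrN; apply: eq_bigr => i _; rewrite mulrNz.
Qed.

Lemma eval_eq (V : zmodType) (e : seq V) a b :
  all (fun i => coef a i == coef b i) (iota 0 (size e)) -> eval e a = eval e b.
Proof.
move=> /allP ab; rewrite !evalE; apply: eq_bigr => i _.
by rewrite (eqP (ab i _)) // mem_iota /= ltn_ord.
Qed.

Ltac insert x e :=
  lazymatch e with
  | [::] => constr:([:: x])
  | x :: _ => e
  | ?y :: ?e' => let e1 := insert x e' in constr:(y :: e1)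
  end.
Ltac vars a e :=
  lazymatch a with
  | 0 => e
  | ?b + ?c => let e1 := vars b e in vars c e1
  | - ?b => vars b e
  | _ => insert a e
  end.
Ltac index x e :=
  lazymatch e with
  | x :: _ => constr:(0%N)
  | _ :: ?e' => let n := index x e' in constr:(n.+1)
  end.
Ltac quote_exp a e :=
  lazymatch a with
  | 0 => constr:(Zero)
  | ?b + ?c => let b1 := quote_exp b e in let c1 := quote_exp c e in
               constr:(Add b1 c1)
  | - ?b => let b1 := quote_exp b e in constr:(Opp b1)
  | _ => let n := index a e in constr:(Var n)
  end.
End ZmodNorm.

Ltac zmod :=
  lazymatch goal with |- @eq ?T ?a ?b =>
    let e := ZmodNorm.vars a (@nil T) in let e := ZmodNorm.vars b e in
    let a1 := ZmodNorm.quote_exp a e in let b1 := ZmodNorm.quote_exp b e in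
    exact: (@ZmodNorm.eval_eq _ e a1 b1 isT)
  end.

Lemma zmod_from (V : zmodType) (a b u v : V) : a = b -> u + b = v + a -> u = v.
Proof. by move=> -> /addIr. Qed.

Section LinearMaps.
Variable K : fieldType.
Implicit Types U V W X : lmodType K.

Definition trilinear U V W X (f : U -> V -> W -> X) : Prop :=
  [/\ forall v w, linear (fun u => f u v w),
      forall u w, linear (fun v => f u v w)
    & forall u v, linear (f u v)].

Lemma linear_ext U V (f g : {linear U -> V}) : f =1 g -> f = g.
Proof.
case: f g => [f [[f1] [f2]]] [g [[g1] [g2]]] /= /funext fg.
by move: fg f1 f2 g1 g2 => -> *; do 3!f_equal; apply: Prop_irrelevance.
Qed.

Lemma bilinear_ext U V W (f g : {bilinear U -> V -> W}) : f =2 g -> f = g.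
Proof.
case: f g => [f [[f1 f2 f3 f4]]] [g [[g1 g2 g3 g4]]] /= fg.
have {}fg : f = g by apply: funext => x; apply: funext.
move: fg f1 f2 f3 f4 g1 g2 g3 g4 => -> *.
by do 3!f_equal; apply: Prop_irrelevance.
Qed.

End LinearMaps.

Section Pullback.
Variables (K : fieldType) (U V W : lmodType K).
Variables (s : {linear U -> W}) (t : {linear V -> W}).

Definition pullback_pred : {pred U * V} := [pred p | s p.1 == t p.2].

Fact pullback_submod_closed : submod_closed pullback_pred.
Proof.
split=> [|a p q]; rewrite !inE /= ?linear0 ?eqxx // => /eqP sp /eqP sq.
by rewrite !linearP sp sq.
Qed.
HB.instance Definition _ :=
  GRing.isSubmodClosed.Build K (U * V)%type pullback_pred
    pullback_submod_closed.

Record pullback := Pullback {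
  pullback_val :> U * V;
  _ : pullback_val \in pullback_pred }.

HB.instance Definition _ := [isSub for pullback_val].
HB.instance Definition _ := [Choice of pullback by <:].
HB.instance Definition _ := [SubChoice_isSubLmodule of pullback by <:].

(* A partial operation on U x_W V, extended by 0 outside its domain. *)
Definition on_pullback (X : lmodType K) (c : pullback -> X) (g : U) (f : V) : X :=
  if insub (g, f) is Some p then c p else 0.

End Pullback.

(* [compm] maps a pair (g, f) with [src g = tgt f] to "g after f". *)
Record twoVect (K : fieldType) := TwoVect {
  ob : lmodType K;
  mor : lmodType K;
  src : {linear mor -> ob};
  tgt : {linear mor -> ob};
  idm : {linear ob -> mor};
  compm : {linear pullback src tgt -> mor};
  src_idm : forall x, src (idm x) = x;
  tgt_idm : forall x, tgt (idm x) = x;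
  src_compm : forall p, src (compm p) = src (val p).2;
  tgt_compm : forall p, tgt (compm p) = tgt (val p).1;
  idm_compm : forall f, on_pullback compm (idm (tgt f)) f = f;
  compm_idm : forall f, on_pullback compm f (idm (src f)) = f;
  compmA : forall h g f, src h = tgt g -> src g = tgt f ->
    on_pullback compm h (on_pullback compm g f) =
    on_pullback compm (on_pullback compm h g) f }.

Arguments src {K _}.
Arguments tgt {K _}.
Arguments idm {K _}.
Arguments compm {K _}.

(* Equal to 0 unless [src g = tgt f]. *)
Definition mcomp (K : fieldType) (V : twoVect K) (g f : mor V) : mor V :=
  on_pullback compm g f.

Notation "g \oc f" := (mcomp g f)
  (at level 45, left associativity, format "g  \oc  f") : ring_scope.

Section TwoVectTheory.
Variables (K : fieldType) (V : twoVect K).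
Implicit Types (x y : ob V) (f g h : mor V).

Definition arrow f x y : Prop := src f = x /\ tgt f = y.

Definition invertible f : Prop :=
  exists g, [/\ arrow g (tgt f) (src f), g \oc f = idm (src f)
              & f \oc g = idm (tgt f)].

Lemma mcompE g f (gf : (g, f) \in pullback_pred src tgt) :
  g \oc f = compm (Pullback gf : pullback _ _).
Proof. by rewrite /mcomp /on_pullback insubT. Qed.

Lemma composable g f : src g = tgt f -> (g, f) \in pullback_pred src tgt.
Proof. by move=> gf; rewrite inE /= gf. Qed.

Lemma arrow_idm x : arrow (idm x) x x.
Proof. by split; rewrite (src_idm, tgt_idm). Qed.

Lemma idm_mcomp f : idm (tgt f) \oc f = f.
Proof. exact: idm_compm. Qed.

Lemma mcomp_idm f : f \oc idm (src f) = f.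
Proof. exact: compm_idm. Qed.

Lemma mcompA h g f : src h = tgt g -> src g = tgt f ->
  h \oc (g \oc f) = (h \oc g) \oc f.
Proof. exact: compmA. Qed.

Lemma arrow_comp x y z g f : arrow g y z -> arrow f x y -> arrow (g \oc f) x z.
Proof.
move=> [sg tg] [sf tf]; have gf : src g = tgt f by rewrite sg tf.
by rewrite (mcompE (composable gf)); split;
  rewrite (src_compm, tgt_compm) /=.
Qed.

Lemma arrowD x y x' y' f g :
  arrow f x y -> arrow g x' y' -> arrow (f + g) (x + x') (y + y').
Proof. by move=> [<- <-] [<- <-]; split; rewrite linearD. Qed.

Lemma comp_linear a g f g' f' : src g = tgt f -> src g' = tgt f' ->
  (a *: g + g') \oc (a *: f + f') = a *: (g \oc f) + g' \oc f'.
Proof.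
move=> gf gf'; have e : src (a *: g + g') = tgt (a *: f + f').
  by rewrite !linearP gf gf'.
rewrite (mcompE (composable e)) (mcompE (composable gf)).
rewrite (mcompE (composable gf')) -(linearP compm).
by congr (compm _); apply: val_inj.
Qed.

Lemma compD g f g' f' : src g = tgt f -> src g' = tgt f' ->
  (g + g') \oc (f + f') = g \oc f + g' \oc f'.
Proof.
by move=> gf gf'; have := comp_linear 1 gf gf'; rewrite !scale1r.
Qed.

Lemma compE g f : src g = tgt f -> g \oc f = g + f - idm (tgt f).
Proof.
move=> gf; have s0 : src (g - idm (tgt f)) = 0.
  by rewrite linearB /= src_idm gf subrr.
have -> : g \oc f = (g - idm (tgt f) + idm (tgt f)) \oc (0 + f).
  by rewrite subrK add0r.
rewrite compD ?src_idm ?s0 ?linear0 // idm_mcomp.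
by rewrite -(linear0 idm) -s0 mcomp_idm; zmod.
Qed.

Lemma comp3E h g f : src h = tgt g -> src g = tgt f ->
  h \oc g \oc f = h + g + f - idm (tgt g) - idm (tgt f).
Proof.
move=> hg gf; have [s _] := arrow_comp (conj hg erefl) (conj erefl erefl).
by rewrite compE ?s // compE //; zmod.
Qed.

End TwoVectTheory.

Record twoFunctor (K : fieldType) (V W : twoVect K) := TwoFunctor {
  F0 : {linear ob V -> ob W};
  F1 : {linear mor V -> mor W};
  src_F1 : forall f, src (F1 f) = F0 (src f);
  tgt_F1 : forall f, tgt (F1 f) = F0 (tgt f);
  F1_idm : forall x, F1 (idm x) = idm (F0 x);
  F1_comp : forall g f, src g = tgt f -> F1 (g \oc f) = F1 g \oc F1 f }.

Lemma twoFunctor_ext (K : fieldType) (V W : twoVect K) (F G : twoFunctor V W) :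
  F0 F =1 F0 G -> F1 F =1 F1 G -> F = G.
Proof.
case: F G => [F0 F1 f1 f2 f3 f4] [G0 G1 g1 g2 g3 g4] /=.
move=> /linear_ext E0 /linear_ext E1; move: E0 E1 f1 f2 f3 f4 g1 g2 g3 g4.
by move=> -> -> *; f_equal; apply: Prop_irrelevance.
Qed.

Section TwoFunctorCat.
Variable K : fieldType.

Definition twoFunctor_id (V : twoVect K) : twoFunctor V V :=
  @TwoFunctor K V V idfun idfun (fun _ => erefl) (fun _ => erefl)
    (fun _ => erefl) (fun _ _ _ => erefl).

Variables (U V W : twoVect K) (G : twoFunctor V W) (F : twoFunctor U V).

Fact twoFunctor_comp_src f : src (F1 G (F1 F f)) = F0 G (F0 F (src f)).
Proof. by rewrite !src_F1. Qed.
Fact twoFunctor_comp_tgt f : tgt (F1 G (F1 F f)) = F0 G (F0 F (tgt f)).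
Proof. by rewrite !tgt_F1. Qed.
Fact twoFunctor_comp_idm x : F1 G (F1 F (idm x)) = idm (F0 G (F0 F x)).
Proof. by rewrite !F1_idm. Qed.
Fact twoFunctor_comp_comp g f : src g = tgt f ->
  F1 G (F1 F (g \oc f)) = F1 G (F1 F g) \oc F1 G (F1 F f).
Proof. by move=> gf; rewrite !F1_comp // src_F1 tgt_F1 gf. Qed.

Definition twoFunctor_comp : twoFunctor U W :=
  @TwoFunctor K U W (F0 G \o F0 F) (F1 G \o F1 F)
    twoFunctor_comp_src twoFunctor_comp_tgt
    twoFunctor_comp_idm twoFunctor_comp_comp.
End TwoFunctorCat.

Section ZinbielAxioms.
Variables (K : fieldType) (V : twoVect K).
Variables (m0 : {bilinear ob V -> ob V -> ob V}).
Variables (m1 : {bilinear mor V -> mor V -> mor V}).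
Variable (J : ob V -> ob V -> ob V -> mor V).
Local Notation "x ** y" := (m0 x y) (at level 40, left associativity).
Local Notation "f *** g" := (m1 f g) (at level 40, left associativity).

Definition bilinear_functor : Prop :=
  [/\ forall f g, src (f *** g) = src f ** src g,
      forall f g, tgt (f *** g) = tgt f ** tgt g,
      forall x y, idm x *** idm y = idm (x ** y)
    & forall g f g' f', src g = tgt f -> src g' = tgt f' ->
        (g \oc f) *** (g' \oc f') = (g *** g') \oc (f *** f')].

Definition zinbielator_arrow : Prop := forall x y z,
  arrow (J x y z) ((x ** y) ** z) (x ** (y ** z) + x ** (z ** y)).

Definition zinbielator_natural : Prop := forall f g h,
  J (tgt f) (tgt g) (tgt h) \oc ((f *** g) *** h) =
  (f *** (g *** h) + f *** (h *** g)) \oc J (src f) (src g) (src h).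

Definition zinbielator_coherent : Prop := forall x y z t,
  (idm x *** J y z t + idm x *** J z y t
     + idm (x ** (t ** (y ** z))) + idm (x ** (t ** (z ** y))))
  \oc (J x (y ** z) t + J x (z ** y) t)
  \oc (J x y z *** idm t)
  = (idm (x ** (y ** (z ** t))) + idm (x ** (y ** (t ** z)))
       + idm x *** J z t y + idm x *** J t z y)
    \oc (J x y (z ** t) + J x y (t ** z))
    \oc J (x ** y) z t.

(* Every composite in [zinbielator_coherent] is one of composable morphisms. *)
Lemma zinbielator_sides_arrow :
  bilinear_functor -> zinbielator_arrow -> forall x y z t,
  let a := ((x ** y) ** z) ** t in
  let b := x ** (y ** (z ** t)) + x ** (y ** (t ** z))
    + x ** (z ** (y ** t)) + x ** (z ** (t ** y))
    + x ** (t ** (y ** z)) + x ** (t ** (z ** y)) in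
  arrow ((idm x *** J y z t + idm x *** J z y t
            + idm (x ** (t ** (y ** z))) + idm (x ** (t ** (z ** y))))
          \oc (J x (y ** z) t + J x (z ** y) t)
          \oc (J x y z *** idm t)) a b /\
  arrow ((idm (x ** (y ** (z ** t))) + idm (x ** (y ** (t ** z)))
            + idm x *** J z t y + idm x *** J t z y)
          \oc (J x y (z ** t) + J x y (t ** z))
          \oc J (x ** y) z t) a b.
Proof.
move=> [src_m tgt_m _ _] aJ x y z t a b.
have mJ u v w r : arrow (idm u *** J v w r) (u ** ((v ** w) ** r))
    (u ** (v ** (w ** r)) + u ** (v ** (r ** w))).
  have [sJ tJ] := aJ v w r.
  by split; rewrite (src_m, tgt_m) (src_idm, tgt_idm) (sJ, tJ) ?linearDr.
have cast f u v u' v' : u = u' -> v = v' -> arrow f u v -> arrow f u' v'.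
  by move=> -> ->.
split.
- apply: (arrow_comp (y := (x ** (y ** z)) ** t + (x ** (z ** y)) ** t)).
    apply: arrow_comp (arrowD (aJ _ _ _) (aJ _ _ _)).
    apply: cast (arrowD (arrowD (arrowD (mJ x y z t) (mJ x z y t))
      (arrow_idm _)) (arrow_idm _)); rewrite /b; zmod.
  have [sJ tJ] := aJ x y z.
  by split; rewrite (src_m, tgt_m) (src_idm, tgt_idm) (sJ, tJ) ?linearDl.
- apply: arrow_comp (aJ _ _ _); apply: arrow_comp (arrowD (aJ _ _ _) (aJ _ _ _)).
  apply: cast (arrowD (arrowD (arrowD (arrow_idm _) (arrow_idm _))
    (mJ x z t y)) (mJ x t z y)); rewrite /b; zmod.
Qed.

End ZinbielAxioms.

Record zinbiel2Alg (K : fieldType) := Zinbiel2Alg {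
  zvect :> twoVect K;
  zmul0 : {bilinear ob zvect -> ob zvect -> ob zvect};
  zmul1 : {bilinear mor zvect -> mor zvect -> mor zvect};
  zmul_functor : bilinear_functor zmul0 zmul1;
  zJ : ob zvect -> ob zvect -> ob zvect -> mor zvect;
  zJ_trilinear : trilinear zJ;
  zJ_arrow : zinbielator_arrow zmul0 zJ;
  zJ_natural : zinbielator_natural zmul1 zJ;
  zJ_invertible : forall x y z, invertible (zJ x y z);
  zJ_coherent : zinbielator_coherent zmul0 zmul1 zJ }.

Arguments zmul0 {K _}.
Arguments zmul1 {K _}.
Arguments zJ {K _}.

Notation "x ** y" := (zmul0 x y) (at level 40, left associativity) : ring_scope.
Notation "f *** g" := (zmul1 f g) (at level 40, left associativity) : ring_scope.

Section ZinbielHomAxioms.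
Variables (K : fieldType) (Z Z' : zinbiel2Alg K) (F : twoFunctor Z Z').
Variable F2 : ob Z -> ob Z -> mor Z'.

Definition zhom_arrow : Prop := forall x y,
  arrow (F2 x y) (F0 F x ** F0 F y) (F0 F (x ** y)).

Definition zhom_natural : Prop := forall f g,
  F2 (tgt f) (tgt g) \oc (F1 F f *** F1 F g) =
  F1 F (f *** g) \oc F2 (src f) (src g).

Definition zhom_coherent : Prop := forall x y z,
  F1 F (zJ x y z) \oc F2 (x ** y) z \oc (F2 x y *** idm (F0 F z))
  = (F2 x (y ** z) + F2 x (z ** y))
    \oc (idm (F0 F x) *** F2 y z + idm (F0 F x) *** F2 z y)
    \oc zJ (F0 F x) (F0 F y) (F0 F z).

End ZinbielHomAxioms.

Record zinbiel2Hom (K : fieldType) (Z Z' : zinbiel2Alg K) := Zinbiel2Hom {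
  zfun :> twoFunctor Z Z';
  F2 : {bilinear ob Z -> ob Z -> mor Z'};
  zhomF2_arrow : zhom_arrow zfun F2;
  zhomF2_natural : zhom_natural zfun F2;
  zhomF2_coherent : zhom_coherent zfun F2 }.

Arguments F2 {K Z Z'}.

Lemma zinbiel2Hom_ext (K : fieldType) (Z Z' : zinbiel2Alg K)
    (F G : zinbiel2Hom Z Z') :
  F0 F =1 F0 G -> F1 F =1 F1 G -> F2 F =2 F2 G -> F = G.
Proof.
case: F G => [F F2 f1 f2 f3] [G G2 g1 g2 g3] /= E0 E1 /bilinear_ext E2.
move: (twoFunctor_ext E0 E1) E2 f1 f2 f3 g1 g2 g3.
by move=> -> -> *; f_equal; apply: Prop_irrelevance.
Qed.

Section SrcTgt.
Variable K : fieldType.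

Lemma src_zmul (Z : zinbiel2Alg K) (f g : mor Z) :
  src (f *** g) = src f ** src g.
Proof. by case: (zmul_functor Z). Qed.
Lemma tgt_zmul (Z : zinbiel2Alg K) (f g : mor Z) :
  tgt (f *** g) = tgt f ** tgt g.
Proof. by case: (zmul_functor Z). Qed.
Lemma zmul_idm (Z : zinbiel2Alg K) (x y : ob Z) :
  idm x *** idm y = idm (x ** y).
Proof. by case: (zmul_functor Z). Qed.
Lemma zmul_comp (Z : zinbiel2Alg K) (g f g' f' : mor Z) :
  src g = tgt f -> src g' = tgt f' ->
  (g \oc f) *** (g' \oc f') = (g *** g') \oc (f *** f').
Proof. by case: (zmul_functor Z) => ? ? ?; apply. Qed.
Lemma src_zJ (Z : zinbiel2Alg K) (x y z : ob Z) :
  src (zJ x y z) = (x ** y) ** z.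
Proof. by case: (zJ_arrow x y z). Qed.
Lemma tgt_zJ (Z : zinbiel2Alg K) (x y z : ob Z) :
  tgt (zJ x y z) = x ** (y ** z) + x ** (z ** y).
Proof. by case: (zJ_arrow x y z). Qed.
Lemma src_F2 (Z Z' : zinbiel2Alg K) (F : zinbiel2Hom Z Z') x y :
  src (F2 F x y) = F0 F x ** F0 F y.
Proof. by case: (zhomF2_arrow F x y). Qed.
Lemma tgt_F2 (Z Z' : zinbiel2Alg K) (F : zinbiel2Hom Z Z') x y :
  tgt (F2 F x y) = F0 F (x ** y).
Proof. by case: (zhomF2_arrow F x y). Qed.

Definition srctgtE :=
  (src_idm, tgt_idm, src_F1, tgt_F1, src_zmul, tgt_zmul, src_zJ, tgt_zJ,
   src_F2, tgt_F2, F1_idm, zmul_idm).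
End SrcTgt.

Lemma zhom_coherentE (K : fieldType) (Z Z' : zinbiel2Alg K)
    (F : twoFunctor Z Z') (F2 : ob Z -> ob Z -> mor Z') :
  zhom_arrow F F2 -> zhom_coherent F F2 <-> forall x y z,
    F1 F (zJ x y z) + F2 (x ** y) z + F2 x y *** idm (F0 F z)
      + idm (F0 F x ** F0 F (y ** z)) + idm (F0 F x ** F0 F (z ** y))
      + idm (F0 F x ** (F0 F y ** F0 F z)) + idm (F0 F x ** (F0 F z ** F0 F y))
    = F2 x (y ** z) + F2 x (z ** y)
      + idm (F0 F x) *** F2 y z + idm (F0 F x) *** F2 z y
      + zJ (F0 F x) (F0 F y) (F0 F z)
      + idm (F0 F ((x ** y) ** z)) + idm (F0 F (x ** y) ** F0 F z).
Proof.
move=> arr; have sF a b := (arr a b).1; have tF a b := (arr a b).2.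
have E x y z : (F1 F (zJ x y z) \oc F2 (x ** y) z \oc (F2 x y *** idm (F0 F z))
    = F1 F (zJ x y z) + F2 (x ** y) z + F2 x y *** idm (F0 F z)
      - idm (F0 F ((x ** y) ** z)) - idm (F0 F (x ** y) ** F0 F z)) *
  ((F2 x (y ** z) + F2 x (z ** y))
    \oc (idm (F0 F x) *** F2 y z + idm (F0 F x) *** F2 z y)
    \oc zJ (F0 F x) (F0 F y) (F0 F z) =
    F2 x (y ** z) + F2 x (z ** y)
      + (idm (F0 F x) *** F2 y z + idm (F0 F x) *** F2 z y)
      + zJ (F0 F x) (F0 F y) (F0 F z)
      - (idm (F0 F x ** F0 F (y ** z)) + idm (F0 F x ** F0 F (z ** y)))
      - (idm (F0 F x ** (F0 F y ** F0 F z))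
         + idm (F0 F x ** (F0 F z ** F0 F y)))).
  split; rewrite comp3E.
  - by rewrite tF tgt_zmul tF tgt_idm.
  - by rewrite src_F1 src_zJ tF.
  - by rewrite sF tgt_zmul tF tgt_idm.
  - by rewrite linearD !tgt_zmul !tgt_idm !tF tgt_zJ !(linearD idm).
  - by rewrite !linearD /= !sF !tgt_zmul !tgt_idm !tF.
  - by rewrite linearD /= !src_zmul !src_idm !sF tgt_zJ.
by split=> H x y z; have := H x y z; rewrite !E => {}H; apply: (zmod_from H);
  zmod.
Qed.

Lemma zhom_naturalE (K : fieldType) (Z Z' : zinbiel2Alg K)
    (F : zinbiel2Hom Z Z') f g :
  F2 F (tgt f) (tgt g) + F1 F f *** F1 F g + idm (F0 F (src f ** src g))
  = F1 F (f *** g) + F2 F (src f) (src g)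
    + idm (F0 F (tgt f) ** F0 F (tgt g)).
Proof.
have := zhomF2_natural F f g; rewrite !compE.
- rewrite tgt_zmul !tgt_F1 tgt_F2 => H; apply: (zmod_from H); zmod.
- by rewrite src_F1 src_zmul tgt_F2.
- by rewrite src_F2 tgt_zmul !tgt_F1.
Qed.

Section ZinbielHomCat.
Variable K : fieldType.

Section Id.
Variable Z : zinbiel2Alg K.

Definition zhom_id_F2 (x y : ob Z) : mor Z := idm (x ** y).
Fact zhom_id_bilinear : bilinear_for *:%R *:%R zhom_id_F2.
Proof. by split=> x a u v; rewrite /zhom_id_F2 (linearPl, linearPr) linearP. Qed.
HB.instance Definition _ :=
  bilinear_isBilinear.Build K (ob Z) (ob Z) (mor Z) *:%R *:%R zhom_id_F2
    zhom_id_bilinear.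

Fact zhom_id_arrow : zhom_arrow (twoFunctor_id Z) zhom_id_F2.
Proof. by move=> x y; apply: arrow_idm. Qed.

Fact zhom_id_natural : zhom_natural (twoFunctor_id Z) zhom_id_F2.
Proof.
move=> f g; rewrite /= /zhom_id_F2 -tgt_zmul -src_zmul.
by rewrite idm_mcomp mcomp_idm.
Qed.

Fact zhom_id_coherent : zhom_coherent (twoFunctor_id Z) zhom_id_F2.
Proof.
move=> x y z; rewrite /= /zhom_id_F2 !zmul_idm -!linearD /=.
rewrite -[in LHS]src_zJ !mcomp_idm.
set w := x ** _; have tJ : tgt (zJ x y z) = w by rewrite tgt_zJ /w linearDr.
have -> : idm w \oc idm w = idm w.
  by rewrite -{1}[w]tgt_idm idm_mcomp.
by rewrite -tJ idm_mcomp.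
Qed.

Definition zinbiel2Hom_id : zinbiel2Hom Z Z :=
  @Zinbiel2Hom K Z Z (twoFunctor_id Z) zhom_id_F2
    zhom_id_arrow zhom_id_natural zhom_id_coherent.
End Id.

Section Comp.
Variables Z Z' Z'' : zinbiel2Alg K.
Variables (G : zinbiel2Hom Z' Z'') (F : zinbiel2Hom Z Z').

Definition zhom_comp_F2 (x y : ob Z) : mor Z'' :=
  F1 G (F2 F x y) \oc F2 G (F0 F x) (F0 F y).

Fact zhom_comp_composable x y :
  src (F1 G (F2 F x y)) = tgt (F2 G (F0 F x) (F0 F y)).
Proof. by rewrite !srctgtE. Qed.

Fact zhom_comp_bilinear : bilinear_for *:%R *:%R zhom_comp_F2.
Proof.
split=> x a u v; rewrite /zhom_comp_F2.
  by rewrite !(linearP, linearPl) comp_linear // zhom_comp_composable.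
by rewrite !(linearP, linearPr) comp_linear // zhom_comp_composable.
Qed.
HB.instance Definition _ :=
  bilinear_isBilinear.Build K (ob Z) (ob Z) (mor Z'') *:%R *:%R zhom_comp_F2
    zhom_comp_bilinear.

Fact zhom_comp_arrow : zhom_arrow (twoFunctor_comp G F) zhom_comp_F2.
Proof.
by move=> x y; apply: (@arrow_comp _ _ _ (F0 G (F0 F x ** F0 F y)));
  split; rewrite !srctgtE.
Qed.

Fact zhom_comp_natural : zhom_natural (twoFunctor_comp G F) zhom_comp_F2.
Proof.
move=> f g; rewrite /= /zhom_comp_F2.
rewrite -mcompA ?srctgtE // -!tgt_F1 zhomF2_natural !src_F1 mcompA ?srctgtE //.
rewrite -F1_comp ?srctgtE // zhomF2_natural F1_comp ?srctgtE //.
by rewrite mcompA ?srctgtE.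
Qed.

Fact zhom_comp_coherent : zhom_coherent (twoFunctor_comp G F) zhom_comp_F2.
Proof.
apply/(zhom_coherentE zhom_comp_arrow) => x y z.
change (F1 G (F1 F (zJ x y z)) + zhom_comp_F2 (x ** y) z
    + zhom_comp_F2 x y *** idm (F0 G (F0 F z))
    + idm (F0 G (F0 F x) ** F0 G (F0 F (y ** z)))
    + idm (F0 G (F0 F x) ** F0 G (F0 F (z ** y)))
    + idm (F0 G (F0 F x) ** (F0 G (F0 F y) ** F0 G (F0 F z)))
    + idm (F0 G (F0 F x) ** (F0 G (F0 F z) ** F0 G (F0 F y)))
  = zhom_comp_F2 x (y ** z) + zhom_comp_F2 x (z ** y)
    + idm (F0 G (F0 F x)) *** zhom_comp_F2 y z
    + idm (F0 G (F0 F x)) *** zhom_comp_F2 z y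
    + zJ (F0 G (F0 F x)) (F0 G (F0 F y)) (F0 G (F0 F z))
    + idm (F0 G (F0 F ((x ** y) ** z)))
    + idm (F0 G (F0 F (x ** y)) ** F0 G (F0 F z))).
have H a b : zhom_comp_F2 a b =
    F1 G (F2 F a b) + F2 G (F0 F a) (F0 F b) - idm (F0 G (F0 F a ** F0 F b)).
  by rewrite /zhom_comp_F2 compE ?zhom_comp_composable // tgt_F2.
rewrite !H {H} !(linearBl, linearBr, linearDl, linearDr, zmul_idm).
have CF := (zhom_coherentE (zhomF2_arrow F)).1 (zhomF2_coherent F) x y z.
move/(congr1 (F1 G)): CF; rewrite !(linearD, F1_idm) => CF.
have CG := (zhom_coherentE (zhomF2_arrow G)).1 (zhomF2_coherent G)
  (F0 F x) (F0 F y) (F0 F z).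
have N1 := zhom_naturalE G (F2 F x y) (idm (F0 F z)).
have N2 a b := zhom_naturalE G (idm (F0 F x)) (F2 F a b).
rewrite !src_F2 !tgt_F2 src_idm tgt_idm F1_idm in N1.
have {}N2 a b : F2 G (F0 F x) (F0 F (a ** b))
    + idm (F0 G (F0 F x)) *** F1 G (F2 F a b)
    + idm (F0 G (F0 F x ** (F0 F a ** F0 F b)))
  = F1 G (idm (F0 F x) *** F2 F a b) + F2 G (F0 F x) (F0 F a ** F0 F b)
    + idm (F0 G (F0 F x) ** F0 G (F0 F (a ** b))).
  by have := N2 a b; rewrite src_F2 tgt_F2 src_idm tgt_idm F1_idm.
apply: (zmod_from (congr2 +%R CF (congr2 +%R CG (congr2 +%R N1
  (congr2 +%R (esym (N2 y z)) (esym (N2 z y))))))).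
zmod.
Qed.

Definition zinbiel2Hom_comp : zinbiel2Hom Z Z'' :=
  @Zinbiel2Hom K Z Z'' (twoFunctor_comp G F) zhom_comp_F2
    zhom_comp_arrow zhom_comp_natural zhom_comp_coherent.
End Comp.

Fact zinbiel2Hom_comp1f (Z Z' : zinbiel2Alg K) (F : zinbiel2Hom Z Z') :
  zinbiel2Hom_comp (zinbiel2Hom_id Z') F = F.
Proof.
apply: zinbiel2Hom_ext => // x y.
change (F2 F x y \oc idm (F0 F x ** F0 F y) = F2 F x y).
by rewrite -src_F2 mcomp_idm.
Qed.

Fact zinbiel2Hom_compf1 (Z Z' : zinbiel2Alg K) (F : zinbiel2Hom Z Z') :
  zinbiel2Hom_comp F (zinbiel2Hom_id Z) = F.
Proof.
apply: zinbiel2Hom_ext => // x y.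
change (F1 F (idm (x ** y)) \oc F2 F x y = F2 F x y).
by rewrite F1_idm -tgt_F2 idm_mcomp.
Qed.

Fact zinbiel2Hom_compA (Z1 Z2 Z3 Z4 : zinbiel2Alg K)
    (H : zinbiel2Hom Z3 Z4) (G : zinbiel2Hom Z2 Z3) (F : zinbiel2Hom Z1 Z2) :
  zinbiel2Hom_comp H (zinbiel2Hom_comp G F) =
  zinbiel2Hom_comp (zinbiel2Hom_comp H G) F.
Proof.
apply: zinbiel2Hom_ext => // x y.
change (F1 H (F1 G (F2 F x y) \oc F2 G (F0 F x) (F0 F y))
    \oc F2 H (F0 G (F0 F x)) (F0 G (F0 F y)) =
  F1 H (F1 G (F2 F x y)) \oc (F1 H (F2 G (F0 F x) (F0 F y))
    \oc F2 H (F0 G (F0 F x)) (F0 G (F0 F y)))).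
rewrite F1_comp ?zhom_comp_composable // mcompA //.
  by rewrite src_F1 tgt_F1 zhom_comp_composable.
by rewrite src_F1 src_F2 tgt_F2.
Qed.

Definition Z2Alg : category :=
  @Category (zinbiel2Alg K) (@zinbiel2Hom K) zinbiel2Hom_id zinbiel2Hom_comp
    zinbiel2Hom_comp1f zinbiel2Hom_compf1 zinbiel2Hom_compA.

End ZinbielHomCat.

Section ZinfAxioms.
Variables (K : fieldType) (V0 V1 : lmodType K) (d : {linear V1 -> V0}).
Variables (l200 : {bilinear V0 -> V0 -> V0}) (l201 : {bilinear V0 -> V1 -> V1}).
Variables (l210 : {bilinear V1 -> V0 -> V1}) (l3 : V0 -> V0 -> V0 -> V1).

Definition zinf_d_l2 : Prop :=
  [/\ forall x h, d (l201 x h) = l200 x (d h),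
      forall h x, d (l210 h x) = l200 (d h) x
    & forall h k, l201 (d h) k = l210 h (d k)].

Definition zinf_d_l3 : Prop := forall x y z,
  d (l3 x y z) = l200 x (l200 y z) + l200 x (l200 z y) - l200 (l200 x y) z.

Definition zinf_l3_d : Prop :=
  [/\ forall x y h, l3 x y (d h) =
        l201 x (l201 y h) + l201 x (l210 h y) - l201 (l200 x y) h,
      forall x h z, l3 x (d h) z =
        l201 x (l210 h z) + l201 x (l201 z h) - l210 (l201 x h) z
    & forall h y z, l3 (d h) y z =
        l210 h (l200 y z) + l210 h (l200 z y) - l210 (l210 h y) z].

Definition zinf_coherent : Prop := forall x y z t,
  l201 x (l3 y z t) + l201 x (l3 z y t) + l3 x (l200 y z + l200 z y) t
    + l210 (l3 x y z) t - l201 x (l3 z t y) - l201 x (l3 t z y)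
    - l3 x y (l200 z t + l200 t z) - l3 (l200 x y) z t = 0.

End ZinfAxioms.

(* [l2ij] is the component of the bracket l_2 on V_i x V_j; the component on
   V_1 x V_1 vanishes. *)
Record zinf2Term (K : fieldType) := Zinf2Term {
  V0 : lmodType K;
  V1 : lmodType K;
  d : {linear V1 -> V0};
  l200 : {bilinear V0 -> V0 -> V0};
  l201 : {bilinear V0 -> V1 -> V1};
  l210 : {bilinear V1 -> V0 -> V1};
  l3 : V0 -> V0 -> V0 -> V1;
  l3_trilinear : trilinear l3;
  d_l2 : zinf_d_l2 d l200 l201 l210;
  d_l3 : zinf_d_l3 d l200 l3;
  l3_d : zinf_l3_d d l200 l201 l210 l3;
  l3_coherent : zinf_coherent l200 l201 l210 l3 }.

Arguments d {K _}.
Arguments l200 {K _}.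
Arguments l201 {K _}.
Arguments l210 {K _}.
Arguments l3 {K _}.

Section ZinfHomAxioms.
Variables (K : fieldType) (V V' : zinf2Term K).
Variables (f0 : {linear V0 V -> V0 V'}) (f1 : {linear V1 V -> V1 V'}).
Variable (f2 : {bilinear V0 V -> V0 V -> V1 V'}).

Definition zinf_hom_l2 : Prop :=
  [/\ forall x y, f0 (l200 x y) - l200 (f0 x) (f0 y) = d (f2 x y),
      forall x a, f1 (l201 x a) - l201 (f0 x) (f1 a) = f2 x (d a)
    & forall a x, f1 (l210 a x) - l210 (f1 a) (f0 x) = f2 (d a) x].

Definition zinf_hom_l3 : Prop := forall x y z,
  f1 (l3 x y z) - l3 (f0 x) (f0 y) (f0 z) =
  f2 x (l200 y z + l200 z y) - f2 (l200 x y) z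
    + l201 (f0 x) (f2 y z + f2 z y) - l210 (f2 x y) (f0 z).

End ZinfHomAxioms.

Record zinf2Hom (K : fieldType) (V V' : zinf2Term K) := Zinf2Hom {
  f0 : {linear V0 V -> V0 V'};
  f1 : {linear V1 V -> V1 V'};
  f2 : {bilinear V0 V -> V0 V -> V1 V'};
  f0_d : forall a, f0 (d a) = d (f1 a);
  f_l2 : zinf_hom_l2 f0 f1 f2;
  f_l3 : zinf_hom_l3 f0 f1 f2 }.

Lemma zinf2Hom_ext (K : fieldType) (V V' : zinf2Term K) (f g : zinf2Hom V V') :
  f0 f =1 f0 g -> f1 f =1 f1 g -> f2 f =2 f2 g -> f = g.
Proof.
case: f g => [f0 f1 f2 ? ? ?] [g0 g1 g2 ? ? ?] /=.
move=> /linear_ext E0 /linear_ext E1 /bilinear_ext E2; subst g0 g1 g2.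
by f_equal; apply: Prop_irrelevance.
Qed.

Section ZinfCat.
Variable K : fieldType.

Section Id.
Variable V : zinf2Term K.

Definition zinf_id_f2 (x y : V0 V) : V1 V := 0.
Fact zinf_id_bilinear : bilinear_for *:%R *:%R zinf_id_f2.
Proof. by split=> x a u v; rewrite /zinf_id_f2 /= scaler0 addr0. Qed.
HB.instance Definition _ :=
  bilinear_isBilinear.Build K (V0 V) (V0 V) (V1 V) *:%R *:%R zinf_id_f2
    zinf_id_bilinear.

Fact zinf_id_l2 : zinf_hom_l2 (V' := V) idfun idfun zinf_id_f2.
Proof. by split=> x y; rewrite /= subrr ?linear0. Qed.

Fact zinf_id_l3 : zinf_hom_l3 (V' := V) idfun idfun zinf_id_f2.
Proof.
move=> x y z; rewrite /= /zinf_id_f2 addr0 linear0r linear0l.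
zmod.
Qed.

Definition zinf2Hom_id : zinf2Hom V V :=
  @Zinf2Hom K V V idfun idfun zinf_id_f2 (fun _ => erefl) zinf_id_l2 zinf_id_l3.
End Id.

Section Comp.
Variables (V V' V'' : zinf2Term K) (g : zinf2Hom V' V'') (f : zinf2Hom V V').

Definition zinf_comp_f2 (x y : V0 V) : V1 V'' :=
  f2 g (f0 f x) (f0 f y) + f1 g (f2 f x y).
Fact zinf_comp_bilinear : bilinear_for *:%R *:%R zinf_comp_f2.
Proof.
by split=> x a u v; rewrite /zinf_comp_f2 !(linearP, linearPl, linearPr) /=
  scalerDr addrACA.
Qed.
HB.instance Definition _ :=
  bilinear_isBilinear.Build K (V0 V) (V0 V) (V1 V'') *:%R *:%R zinf_comp_f2
    zinf_comp_bilinear.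

Fact zinf_comp_d a : f0 g (f0 f (d a)) = d (f1 g (f1 f a)).
Proof. by rewrite !f0_d. Qed.

Fact zinf_comp_l2 :
  zinf_hom_l2 (f0 g \o f0 f) (f1 g \o f1 f) zinf_comp_f2.
Proof.
have [F1 F2 F3] := f_l2 f; have [G1 G2 G3] := f_l2 g.
split=> x y; rewrite /zinf_comp_f2.
- change (f0 g (f0 f (l200 x y)) - l200 (f0 g (f0 f x)) (f0 g (f0 f y)) =
    d (f2 g (f0 f x) (f0 f y) + f1 g (f2 f x y))).
  rewrite -[f0 f (l200 x y)](subrK (l200 (f0 f x) (f0 f y))) F1 !linearD /=.
  by rewrite -G1 f0_d; zmod.
- change (f1 g (f1 f (l201 x y)) - l201 (f0 g (f0 f x)) (f1 g (f1 f y)) =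
    f2 g (f0 f x) (f0 f (d y)) + f1 g (f2 f x (d y))).
  rewrite -[f1 f (l201 x y)](subrK (l201 (f0 f x) (f1 f y))) F2 linearD /=.
  by rewrite f0_d -G2; zmod.
- change (f1 g (f1 f (l210 x y)) - l210 (f1 g (f1 f x)) (f0 g (f0 f y)) =
    f2 g (f0 f (d x)) (f0 f y) + f1 g (f2 f (d x) y)).
  rewrite -[f1 f (l210 x y)](subrK (l210 (f1 f x) (f0 f y))) F3 linearD /=.
  by rewrite f0_d -G3; zmod.
Qed.

Fact zinf_comp_l3 :
  zinf_hom_l3 (f0 g \o f0 f) (f1 g \o f1 f) zinf_comp_f2.
Proof.
have [F1 F2 F3] := f_l2 f; have [G1 G2 G3] := f_l2 g.
move=> x y z; rewrite /zinf_comp_f2.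
change (f1 g (f1 f (l3 x y z))
    - l3 (f0 g (f0 f x)) (f0 g (f0 f y)) (f0 g (f0 f z)) =
  f2 g (f0 f x) (f0 f (l200 y z + l200 z y))
    + f1 g (f2 f x (l200 y z + l200 z y))
    - (f2 g (f0 f (l200 x y)) (f0 f z) + f1 g (f2 f (l200 x y) z))
    + l201 (f0 g (f0 f x)) (f2 g (f0 f y) (f0 f z) + f1 g (f2 f y z)
        + (f2 g (f0 f z) (f0 f y) + f1 g (f2 f z y)))
    - l210 (f2 g (f0 f x) (f0 f y) + f1 g (f2 f x y)) (f0 g (f0 f z))).
have D1 a b : f0 f (l200 a b) = d (f2 f a b) + l200 (f0 f a) (f0 f b).
  by rewrite -F1 subrK.
have L3 : f1 f (l3 x y z) + f2 f (l200 x y) z + l210 (f2 f x y) (f0 f z) =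
    f2 f x (l200 y z + l200 z y) + l201 (f0 f x) (f2 f y z + f2 f z y)
    + l3 (f0 f x) (f0 f y) (f0 f z).
  by apply: (zmod_from (f_l3 f x y z)); zmod.
move/(congr1 (f1 g)): L3; rewrite !linearD /= => E.
have E' := f_l3 g (f0 f x) (f0 f y) (f0 f z).
rewrite !D1 !linearD /= !linearDl.
rewrite !(linearD, linearDr) /= in E'.
rewrite -!G2 -!G3.
apply: (zmod_from (congr2 +%R E E')).
zmod.
Qed.

Definition zinf2Hom_comp : zinf2Hom V V'' :=
  @Zinf2Hom K V V'' (f0 g \o f0 f) (f1 g \o f1 f) zinf_comp_f2
    zinf_comp_d zinf_comp_l2 zinf_comp_l3.
End Comp.

Fact zinf2Hom_comp1f (V V' : zinf2Term K) (f : zinf2Hom V V') :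
  zinf2Hom_comp (zinf2Hom_id V') f = f.
Proof. by apply: zinf2Hom_ext => // x y; apply: add0r. Qed.

Fact zinf2Hom_compf1 (V V' : zinf2Term K) (f : zinf2Hom V V') :
  zinf2Hom_comp f (zinf2Hom_id V) = f.
Proof.
apply: zinf2Hom_ext => // x y.
by rewrite /= /zinf_comp_f2 /= /zinf_id_f2 linear0 addr0.
Qed.

Fact zinf2Hom_compA (V1 V2 V3 V4 : zinf2Term K)
    (h : zinf2Hom V3 V4) (g : zinf2Hom V2 V3) (f : zinf2Hom V1 V2) :
  zinf2Hom_comp h (zinf2Hom_comp g f) = zinf2Hom_comp (zinf2Hom_comp h g) f.
Proof.
apply: zinf2Hom_ext => // x y.
by rewrite /= /zinf_comp_f2 /= /zinf_comp_f2 linearD addrA.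
Qed.

Definition TwoTermZinf : category :=
  @Category (zinf2Term K) (@zinf2Hom K) zinf2Hom_id zinf2Hom_comp
    zinf2Hom_comp1f zinf2Hom_compf1 zinf2Hom_compA.

End ZinfCat.

(* Main.v *)
From HB Require Import structures.
From mathcomp Require Import all_boot all_algebra.
From mathcomp Require Import boolp.
Require Import Defs.

(** The idea is that a 2-vector space is a 2-term complex in disguise. A
    morphism [f] is the sum of the identity of its source and of its arrow part
    [f - 1_(src f)], which lies in the kernel of [src]; composition adds arrow
    parts. Hence a 2-vector space is determined by its objects, the kernel of
    [src] and the target map between them, and every linear expression in
    composites can be rewritten as a sum.

    Under this dictionary a 2-term algebra [V] gives a Zinbiel 2-algebra with
    objects [V0] and morphisms [V0 * V1], where [(x, h)] goes from [x] to
    [x + d h]; the product is built from [l2], and the arrow part of the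
    Zinbielator is [l3]. A Z-infinity-homomorphism [(f0, f1, f2)] gives a
    homomorphism whose structure morphism [F2] has arrow part [f2]. This defines
    the functor [zinf_to_zinbiel], which is shown to be an equivalence by
    [equivalence_of_fully_faithful]:
    - it is faithful, since [f0], [f1], [f2] can be read off its value;
    - it is full ([zinf2Hom_of_zhomK]), because any homomorphism [F] is forced
      to have the above shape ([zhom_F1E], [zhom_F2E]), and for maps of that
      shape the axioms of a homomorphism of 2-algebras and those of a
      Z-infinity-homomorphism are equivalent ([zhom_arrow_natural_zinfE],
      [zhom_coherent_zinfE]);
    - it is essentially surjective ([zinf_to_zinbiel_ess_surj]): the objects of
      a Zinbiel 2-algebra [Z] and the kernel of its source map form a 2-term
      algebra, and the splitting of morphisms into identities and arrow parts is
      an isomorphism of its image with [Z].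

    The equations relating the two sides come from three sources: naturality of
    [J] at an element of the kernel in one slot gives the laws for [l3] at a
    boundary ([core_l3_d]), the interchange law gives
    [l2 (d h, k) = l2 (h, d k)] ([core_mulE]), and the coherence of [J] is the
    last axiom of a 2-term algebra once all identity morphisms have cancelled
    ([zinbielator_coherentE]). *)

Set Implicit Arguments.
Unset Strict Implicit.
Unset Printing Implicit Defensive.
Import GRing.Theory.
Local Open Scope ring_scope.

(** * Fully faithful and essentially surjective functors *)

Section Equivalence.
Variables (C D : category) (F : functor C D).

(** A quasi-inverse is obtained by choosing, for every [X : D], an object and an
    isomorphism [e X] from its image to [X]: fullness lifts the conjugate of a
    morphism by [e], faithfulness turns every equation to be checked in [C]
    into one in [D], and there the [e X] cancel. Both natural isomorphisms are
    made of the [e X], so their naturality costs nothing. *)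
Lemma equivalence_of_fully_faithful :
  (forall (A B : C) (f g : hom A B), fhom F f = fhom F g -> f = g) ->
  (forall (A B : C) (u : hom (F A) (F B)), exists f, fhom F f = u) ->
  (forall X : D, exists (A : C) (e : hom (F A) X), cat_iso e) ->
  equivalent_categories C D.
Proof.
move=> faith full surj.
pose G0 X := projT1 (cid (surj X)).
pose e X : hom (F (G0 X)) X := projT1 (cid (projT2 (cid (surj X)))).
have e_iso X : cat_iso (e X) := projT2 (cid (projT2 (cid (surj X)))).
pose e' X := projT1 (cid (e_iso X)).
have e'e X : catcomp (e' X) (e X) = catid (F (G0 X)) :=
  (projT2 (cid (e_iso X))).1.
have ee' X : catcomp (e X) (e' X) = catid X := (projT2 (cid (e_iso X))).2.
pose lift A B (u : hom (F A) (F B)) := projT1 (cid (full A B u)).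
have liftK A B (u : hom (F A) (F B)) : fhom F (lift A B u) = u :=
  projT2 (cid (full A B u)).
pose G1 X Y (u : hom X Y) : hom (G0 X) (G0 Y) :=
  lift _ _ (catcomp (e' Y) (catcomp u (e X))).
have G1_id X : G1 _ _ (catid X) = catid (G0 X).
  by apply: faith; rewrite liftK catcomp1f e'e fhom_id.
have G1_comp X Y Z (v : hom Y Z) (u : hom X Y) :
    G1 _ _ (catcomp v u) = catcomp (G1 _ _ v) (G1 _ _ u).
  apply: faith; rewrite fhom_comp !liftK -!catcompA; congr catcomp.
  congr catcomp; rewrite [in RHS](catcompA (e Y)) ee' catcomp1f //.
pose G := Functor G1_id G1_comp.
exists F, G; split.
  exists (fun A => lift A (G0 (F A)) (e' (F A))); split=> [A B f|A].
    apply: faith; rewrite !fhom_comp /= !liftK.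
    by rewrite -!catcompA ee' catcompf1.
  by exists (lift _ _ (e (F A))); split; apply: faith;
    rewrite fhom_comp !liftK fhom_id ?ee' ?e'e.
exists e; split=> [X Y u|X]; last exact: e_iso.
by rewrite /= liftK catcompA ee' catcomp1f.
Qed.

End Equivalence.

(** * Linear maps and arrow parts in 2-vector spaces *)

Section Generalities.
Variable K : fieldType.

(** The laws of (bi)linear maps, with both sides typed by the module structures
    of the statement: generic rewriting rules leave sums over structures that
    are only convertible to these, whose terms [zmod] then fails to identify. *)
Lemma linD (U V : lmodType K) (f : {linear U -> V}) x y :
  f (x + y) = f x + f y.
Proof. exact: linearD. Qed.

Lemma linDl (U V W : lmodType K) (f : {bilinear U -> V -> W}) x y z :
  f (x + y) z = f x z + f y z.
Proof. exact: linearDl. Qed.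

Lemma linDr (U V W : lmodType K) (f : {bilinear U -> V -> W}) x y z :
  f z (x + y) = f z x + f z y.
Proof. exact: linearDr. Qed.

Lemma linB (U V : lmodType K) (f : {linear U -> V}) x y :
  f (x - y) = f x - f y.
Proof. exact: linearB. Qed.

Lemma linBl (U V W : lmodType K) (f : {bilinear U -> V -> W}) x y z :
  f (x - y) z = f x z - f y z.
Proof. exact: linearBl. Qed.

Lemma linBr (U V W : lmodType K) (f : {bilinear U -> V -> W}) x y z :
  f z (x - y) = f z x - f z y.
Proof. exact: linearBr. Qed.

(** A 2-vector space is a groupoid: composition is [g + f - 1], so
    [1_(src f) + 1_(tgt f) - f] is inverse to [f]. *)
Lemma mor_invertible (V : twoVect K) (f : mor V) : invertible f.
Proof.
exists (idm (src f) + idm (tgt f) - f).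
set g := _ - f; have sg : src g = tgt f.
  by rewrite linB linearD /= !src_idm; zmod.
have tg : tgt g = src f by rewrite linB linearD /= !tgt_idm; zmod.
by split=> //; rewrite compE ?tg // /g; zmod.
Qed.

(** Composition is an affine expression in the morphisms and an identity, so
    linear maps that respect sources, targets and identities respect it. *)
Lemma preserves_mcomp (V W : twoVect K)
    (F0 : {linear ob V -> ob W}) (F1 : {linear mor V -> mor W}) :
  (forall f, src (F1 f) = F0 (src f)) -> (forall f, tgt (F1 f) = F0 (tgt f)) ->
  (forall x, F1 (idm x) = idm (F0 x)) ->
  forall g f, src g = tgt f -> F1 (g \oc f) = F1 g \oc F1 f.
Proof.
move=> sF tF iF g f gf; rewrite !compE ?sF ?tF ?gf //.
by rewrite linearB linearD /= iF.
Qed.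

Lemma linear_fun_add (U V : lmodType K) (f : U -> V) :
  linear f -> {morph f : x y / x + y}.
Proof. by move=> lin_f x y; rewrite -[x]scale1r lin_f !scale1r. Qed.

Lemma linear_fun0 (U V : lmodType K) (f : U -> V) : linear f -> f 0 = 0.
Proof.
move=> lin_f; have := linear_fun_add lin_f 0 0.
by rewrite addr0 => f0; apply: (addIr (f 0)); rewrite add0r.
Qed.

(** The component of [f] in the kernel of [src], in the decomposition of the
    morphisms as the direct sum of identities and that kernel. *)
Definition arrow_part (V : twoVect K) (f : mor V) : mor V := f - idm (src f).

Lemma src_arrow_part (V : twoVect K) (f : mor V) : src (arrow_part f) = 0.
Proof. by rewrite linB src_idm subrr. Qed.

(** Coherence of the Zinbielator is the last axiom of a 2-term algebra in
    disguise: writing composites as sums, and every [J] as its arrow part plus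
    the identity of its source, all identities cancel except that of
    [((x y) z) t], which occurs once on each side. *)
Lemma zinbielator_coherentE (V : twoVect K)
    (m0 : {bilinear ob V -> ob V -> ob V})
    (m1 : {bilinear mor V -> mor V -> mor V})
    (J : ob V -> ob V -> ob V -> mor V) :
  bilinear_functor m0 m1 -> zinbielator_arrow m0 J ->
  let j x y z := arrow_part (J x y z) in
  zinbielator_coherent m0 m1 J <-> forall x y z t,
    m1 (idm x) (j y z t) + m1 (idm x) (j z y t)
      + (j x (m0 y z) t + j x (m0 z y) t) + m1 (j x y z) (idm t)
    = m1 (idm x) (j z t y) + m1 (idm x) (j t z y)
      + (j x y (m0 z t) + j x y (m0 t z)) + j (m0 x y) z t.
Proof.
move=> [src_m tgt_m idm_m _] aJ j.
have sJ x y z : src (J x y z) = m0 (m0 x y) z by case: (aJ x y z).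
have tJ x y z : tgt (J x y z) = m0 x (m0 y z) + m0 x (m0 z y).
  by case: (aJ x y z).
have sides x y z t :
  ((m1 (idm x) (J y z t) + m1 (idm x) (J z y t)
     + idm (m0 x (m0 t (m0 y z))) + idm (m0 x (m0 t (m0 z y))))
  \oc (J x (m0 y z) t + J x (m0 z y) t)
  \oc (m1 (J x y z) (idm t))
  = m1 (idm x) (j y z t) + m1 (idm x) (j z y t)
      + (j x (m0 y z) t + j x (m0 z y) t) + m1 (j x y z) (idm t)
      + idm (m0 (m0 (m0 x y) z) t)) *
  ((idm (m0 x (m0 y (m0 z t))) + idm (m0 x (m0 y (m0 t z)))
       + m1 (idm x) (J z t y) + m1 (idm x) (J t z y))
    \oc (J x y (m0 z t) + J x y (m0 t z))
    \oc J (m0 x y) z t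
   = m1 (idm x) (j z t y) + m1 (idm x) (j t z y)
      + (j x y (m0 z t) + j x y (m0 t z)) + j (m0 x y) z t
      + idm (m0 (m0 (m0 x y) z) t)).
  split; rewrite comp3E;
    rewrite ?(linearD (@src K V)) ?(linearD (@tgt K V)) /= ?src_m ?tgt_m.
  - rewrite /j /arrow_part !sJ !tJ !linBr !linBl !idm_m !tgt_idm.
    by rewrite !linearD /= !linearDl !linearD /=; zmod.
  - by rewrite !src_idm !tJ !sJ; zmod.
  - by rewrite !sJ !tJ tgt_idm linearDl.
  - rewrite /j /arrow_part !sJ !tJ !linBr !idm_m.
    by rewrite !(linearD idm) /=; zmod.
  - by rewrite !src_idm !tJ !sJ; zmod.
  - by rewrite !sJ !tJ.
split=> H x y z t; have := H x y z t; rewrite !sides; last by move=> ->.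
exact: addIr.
Qed.

End Generalities.

(** * The 2-vector space of a 2-term complex *)

Section TwoVectOfComplex.
Variables (K : fieldType) (A B : lmodType K) (d : {linear B -> A}).

(** A pair [(x, h)] is the arrow [h] issuing from [x]; it ends at [x + d h]. *)
Definition cpx_tgt (f : A * B) : A := f.1 + d f.2.
Fact cpx_tgt_linear : linear cpx_tgt.
Proof.
move=> a f g; rewrite /cpx_tgt /= linearP /= scalerDr; zmod.
Qed.
HB.instance Definition _ :=
  GRing.isLinear.Build K (A * B)%type A *:%R cpx_tgt cpx_tgt_linear.

Definition cpx_idm (x : A) : A * B := (x, 0).
Fact cpx_idm_linear : linear cpx_idm.
Proof. by move=> a x y; congr (_, _); rewrite /= scaler0 addr0. Qed.
HB.instance Definition _ :=
  GRing.isLinear.Build K A (A * B)%type *:%R cpx_idm cpx_idm_linear.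

Definition cpx_src : {linear (A * B)%type -> A} := fst.

Definition cpx_comp (p : pullback cpx_src cpx_tgt) : A * B :=
  ((val p).2.1, (val p).1.2 + (val p).2.2).
Fact cpx_comp_linear : linear cpx_comp.
Proof.
move=> a p q; congr (_, _); rewrite /= scalerDr; zmod.
Qed.
HB.instance Definition _ :=
  GRing.isLinear.Build K (pullback cpx_src cpx_tgt) (A * B)%type *:%R cpx_comp
    cpx_comp_linear.

Fact cpx_on_comp (g f : A * B) : g.1 = cpx_tgt f ->
  on_pullback cpx_comp g f = (f.1, g.2 + f.2).
Proof.
move=> gf; rewrite /on_pullback insubT // inE /=.
exact/eqP.
Qed.

Fact cpx_src_idm x : cpx_src (cpx_idm x) = x.
Proof. by []. Qed.
Fact cpx_tgt_idm x : cpx_tgt (cpx_idm x) = x.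
Proof. by rewrite /cpx_tgt linear0 addr0. Qed.
Fact cpx_src_comp p : cpx_src (cpx_comp p) = cpx_src (val p).2.
Proof. by []. Qed.
Fact cpx_tgt_comp p : cpx_tgt (cpx_comp p) = cpx_tgt (val p).1.
Proof.
case: p => -[g f] gf; have /eqP /= E := gf.
by rewrite /cpx_tgt /= linearD E /cpx_tgt; zmod.
Qed.
Fact cpx_idm_comp f : on_pullback cpx_comp (cpx_idm (cpx_tgt f)) f = f.
Proof. by rewrite cpx_on_comp // add0r; case: f. Qed.
Fact cpx_comp_idm f : on_pullback cpx_comp f (cpx_idm (cpx_src f)) = f.
Proof. by rewrite cpx_on_comp ?cpx_tgt_idm //= addr0; case: f. Qed.
Fact cpx_compA h g f : cpx_src h = cpx_tgt g -> cpx_src g = cpx_tgt f ->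
  on_pullback cpx_comp h (on_pullback cpx_comp g f) =
  on_pullback cpx_comp (on_pullback cpx_comp h g) f.
Proof.
move=> hg gf; rewrite !(@cpx_on_comp _ f) ?(@cpx_on_comp h g) //=.
rewrite cpx_on_comp /= ?addrA // hg /cpx_tgt /= linearD /=.
by move: gf; rewrite /cpx_tgt /= => ->; zmod.
Qed.

Definition twoVect_of_complex : twoVect K :=
  @TwoVect K A (A * B)%type cpx_src cpx_tgt cpx_idm cpx_comp
    cpx_src_idm cpx_tgt_idm cpx_src_comp cpx_tgt_comp
    cpx_idm_comp cpx_comp_idm cpx_compA.

Lemma mcomp_complex (g f : mor twoVect_of_complex) :
  src g = tgt f -> g \oc f = (f.1, g.2 + f.2).
Proof. exact: cpx_on_comp. Qed.

End TwoVectOfComplex.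

(** * The Zinbiel 2-algebra of a 2-term Z-infinity-algebra *)

Section ZinbielOfZinf.
Variables (K : fieldType) (V : zinf2Term K).

Local Notation TV := (twoVect_of_complex (@d K V)).

(** This is the horizontal composite of [tgt f] acting on [g] with [f] acting on
    [src g]. The relation [l2 (d h, k) = l2 (h, d k)] makes it equal to the
    symmetric expression [src f] on [g] plus [f] on [tgt g], and is what makes
    the interchange law hold. *)
Definition zinf_mul (f g : mor TV) : mor TV :=
  (l200 f.1 g.1, l201 (tgt f) g.2 + l210 f.2 g.1).

Fact zinf_mul_bilinear : bilinear_for *:%R *:%R zinf_mul.
Proof.
split=> f a g h; congr (_, _).
- exact: linearPl.
- by rewrite linearP linearPl /= linearPl /= scalerDr addrACA.
- exact: linearPr.
- by rewrite linearPr linearPr /= scalerDr addrACA.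
Qed.
HB.instance Definition _ :=
  bilinear_isBilinear.Build K (mor TV) (mor TV) (mor TV) *:%R *:%R zinf_mul
    zinf_mul_bilinear.

Definition zinf_zmul0 : {bilinear ob TV -> ob TV -> ob TV} := l200.
Definition zinf_zmul1 : {bilinear mor TV -> mor TV -> mor TV} := zinf_mul.

Fact zinf_mul_functor : bilinear_functor zinf_zmul0 zinf_zmul1.
Proof.
have [d01 d10 d11] := d_l2 V.
have tgt_mul f g : tgt (zinf_mul f g) = l200 (tgt f) (tgt g).
  case: f g => [x h] [y k].
  change (l200 x y + d (l201 (x + d h) k + l210 h y)
    = l200 (x + d h) (y + d k)).
  by rewrite linD d01 d10 !linDl !linDr; zmod.
split=> [//|//|x y|g f g' f' gf gf'].
  change ((l200 x y, l201 (x + d 0) 0 + l210 0 y) = (l200 x y, 0) :> mor TV).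
  by rewrite !linear0r linear0l addr0.
have sgg : src (zinf_mul g g') = tgt (zinf_mul f f').
  by rewrite tgt_mul -gf -gf'.
rewrite !mcomp_complex //.
change (zinf_mul (f.1, g.2 + f.2) (f'.1, g'.2 + f'.2) =
  ((zinf_mul f f').1, (zinf_mul g g').2 + (zinf_mul f f').2)).
congr (_, _); move: g f g' f' gf gf' {sgg}.
move=> [x1 h1] [x h] [y1 k1] [y k] E E'.
have {E} : x1 = x + d h by exact: E.
have {E'} : y1 = y + d k by exact: E'.
move=> -> ->.
(* The sides differ by [l201 (d h1) k] on the left against [l210 h1 (d k)] on
   the right. *)
change (l201 (x + d (h1 + h)) (k1 + k) + l210 (h1 + h) y =
  l201 (x + d h + d h1) k1 + l210 h1 (y + d k) +
  (l201 (x + d h) k + l210 h y)).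
rewrite !(linDl, linDr, linD) -!d11.
zmod.
Qed.

Lemma zinf_mul_idml (x y : V0 V) (h : V1 V) :
  zinf_zmul1 (idm (x : ob TV)) (y, h) = (l200 x y, l201 x h) :> mor TV.
Proof. by congr (_, _); rewrite tgt_idm /= linear0l addr0. Qed.

Lemma zinf_mul_idmr (x y : V0 V) (h : V1 V) :
  zinf_zmul1 (x, h) (idm (y : ob TV)) = (l200 x y, l210 h y) :> mor TV.
Proof. by congr (_, _); rewrite /= linear0r add0r. Qed.

Definition zinf_J (x y z : ob TV) : mor TV := (l200 (l200 x y) z, l3 x y z).

Lemma l3D : [/\ forall x x' y z : V0 V, l3 (x + x') y z = l3 x y z + l3 x' y z,
  forall x y y' z : V0 V, l3 x (y + y') z = l3 x y z + l3 x y' z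
  & forall x y z z' : V0 V, l3 x y (z + z') = l3 x y z + l3 x y z'].
Proof.
have [L1 L2 L3] := l3_trilinear V.
split=> *; [exact: (linear_fun_add (L1 _ _)) | exact: (linear_fun_add (L2 _ _))
  | exact: (linear_fun_add (L3 _ _))].
Qed.

Fact zinf_J_trilinear : trilinear zinf_J.
Proof.
have [L1 L2 L3] := l3_trilinear V.
split=> u v a x y; congr (_, _); rewrite ?L1 ?L2 ?L3 //=.
- by rewrite linearPl linearPl.
- by rewrite linearPr linearPl.
- by rewrite linearPr.
Qed.

Fact zinf_J_arrow : zinbielator_arrow zinf_zmul0 zinf_J.
Proof.
move=> x y z; split=> //.
change (l200 (l200 x y) z + d (l3 x y z) =
  l200 x (l200 y z) + l200 x (l200 z y)).
by rewrite d_l3; zmod.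
Qed.

(** [l3 (x + d u, y + d v, z + d w)] is expanded one slot at a time; the three
    laws for [l3] with a boundary in one slot give exactly the terms by which
    the two bracketings differ. *)
Fact zinf_J_natural : zinbielator_natural zinf_zmul1 zinf_J.
Proof.
have [Dx Dy Dz] := l3D; have [d01 d10 d11] := d_l2 V.
have [L3 L2 L1] := l3_d V; have [src_m tgt_m _ _] := zinf_mul_functor.
move=> f g h; rewrite !mcomp_complex.
- change ((l200 (l200 f.1 g.1) h.1,
      l3 (tgt f) (tgt g) (tgt h)
      + (l201 (tgt (zinf_zmul1 f g)) h.2
         + l210 (l201 (tgt f) g.2 + l210 f.2 g.1) h.1)) =
    (l200 (l200 f.1 g.1) h.1,
      l201 (tgt f) (l201 (tgt g) h.2 + l210 g.2 h.1)
      + l210 f.2 (l200 g.1 h.1)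
      + (l201 (tgt f) (l201 (tgt h) g.2 + l210 h.2 g.1)
         + l210 f.2 (l200 h.1 g.1))
      + l3 f.1 g.1 h.1) :> mor TV).
  congr (_, _); rewrite tgt_m.
  case: f g h => [x u] [y v] [z w].
  change (l3 (x + d u) (y + d v) (z + d w)
      + (l201 (l200 (x + d u) (y + d v)) w
         + l210 (l201 (x + d u) v + l210 u y) z) =
      l201 (x + d u) (l201 (y + d v) w + l210 v z)
      + l210 u (l200 y z)
      + (l201 (x + d u) (l201 (z + d w) v + l210 w y)
         + l210 u (l200 z y))
      + l3 x y z).
  (* [x + d u] stays one variable wherever both sides contain it; it is split
     only in the first slot of [l3]. *)
  have := Dx x (d u) y z; rewrite L1; move: (x + d u) => x' E1.
  rewrite Dz L3 Dy L2 E1 !(linDl, linDr, d11); zmod.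
- by rewrite linD !src_m !(zinf_J_arrow _ _ _).2.
- by rewrite tgt_m tgt_m !(zinf_J_arrow _ _ _).1.
Qed.

Fact zinf_J_coherent : zinbielator_coherent zinf_zmul0 zinf_zmul1 zinf_J.
Proof.
have [Dx Dy Dz] := l3D.
apply/(zinbielator_coherentE zinf_mul_functor zinf_J_arrow) => x y z t.
have jE a b c : arrow_part (zinf_J a b c) = (0, l3 a b c) :> mor TV.
  by congr (_, _); rewrite /= ?subrr ?subr0.
rewrite !jE !zinf_mul_idml !zinf_mul_idmr !linear0r !linear0l; congr (_, _).
have := l3_coherent x y z t; rewrite Dy Dz => C; apply: (zmod_from C).
by rewrite /= /zinf_zmul0; zmod.
Qed.

Definition zinbiel_of_zinf : zinbiel2Alg K :=
  @Zinbiel2Alg K TV zinf_zmul0 zinf_zmul1 zinf_mul_functor zinf_J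
    zinf_J_trilinear zinf_J_arrow zinf_J_natural
    (fun x y z => mor_invertible (zinf_J x y z)) zinf_J_coherent.

End ZinbielOfZinf.

(** * Homomorphisms in components *)

(** The shape of [F1] and [F2] assumed here is that of the homomorphism built
    from a Z-infinity-homomorphism, and turns out to be that of every
    homomorphism; the equivalences below are therefore used in one direction to
    define the functor on morphisms and in the other to prove it full. *)
Section HomComponents.
Variables (K : fieldType) (V V' : zinf2Term K).
Local Notation Z := (zinbiel_of_zinf V).
Local Notation Z' := (zinbiel_of_zinf V').
Variables (F : twoFunctor Z Z') (F2 : ob Z -> ob Z -> mor Z').
Variables (f1 : {linear V1 V -> V1 V'}).
Variables (f2 : {bilinear V0 V -> V0 V -> V1 V'}).
Local Notation f0 := (F0 F : {linear V0 V -> V0 V'}).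
Hypothesis F1E : forall x h, F1 F (x, h) = (f0 x, f1 h) :> mor Z'.
Hypothesis F2E : forall x y, F2 x y = (l200 (f0 x) (f0 y), f2 x y) :> mor Z'.

Lemma zhom_arrow_zinfE : zhom_arrow F F2 <->
  forall x y, f0 (l200 x y) - l200 (f0 x) (f0 y) = d (f2 x y).
Proof.
have tF2 x y : tgt (F2 x y) = l200 (f0 x) (f0 y) + d (f2 x y) :> V0 V'.
  by rewrite F2E.
split=> [arr|H] x y.
  have [_ t2] := arr x y.
  have E : f0 (l200 x y) = l200 (f0 x) (f0 y) + d (f2 x y).
    by rewrite -tF2 t2.
  by rewrite E; zmod.
split; first by rewrite F2E.
by rewrite tF2 -H addrC subrK.
Qed.

(** Only the second components of the naturality square carry information; the
    square at [(x, u)] and [(y, v)] becomes the displayed identity. *)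
Lemma zhom_natural_zinfE : zhom_arrow F F2 -> zhom_natural F F2 <->
  forall (x : V0 V) (u : V1 V) (y : V0 V) (v : V1 V),
    f2 (x + d u) (y + d v)
      + (l201 (f0 (x + d u)) (f1 v) + l210 (f1 u) (f0 y))
    = f1 (l201 (x + d u) v + l210 u y) + f2 x y.
Proof.
move=> arr; have sF a b := (arr a b).1; have tF a b := (arr a b).2.
have sides x u y v (f := (x, u) : mor Z) (g := (y, v) : mor Z) :
  (F2 (tgt f) (tgt g) \oc (F1 F f *** F1 F g) =
    (l200 (f0 x) (f0 y), f2 (x + d u) (y + d v)
      + (l201 (f0 (x + d u)) (f1 v) + l210 (f1 u) (f0 y))) :> mor Z') *
  (F1 F (f *** g) \oc F2 (src f) (src g) =
    (l200 (f0 x) (f0 y), f1 (l201 (x + d u) v + l210 u y) + f2 x y)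
    :> mor Z').
  have mF : F1 F f *** F1 F g = (l200 (f0 x) (f0 y),
      l201 (f0 (x + d u)) (f1 v) + l210 (f1 u) (f0 y)) :> mor Z'.
    rewrite -[f0 (x + d u)](tgt_F1 F f) !F1E; reflexivity.
  have c1 : src (F2 (tgt f) (tgt g)) = tgt (F1 F f *** F1 F g).
    by rewrite sF tgt_zmul !tgt_F1.
  have c2 : src (F1 F (f *** g)) = tgt (F2 (src f) (src g)).
    by rewrite tF src_F1 src_zmul.
  split; first by rewrite (mcomp_complex c1) F2E mF.
  by rewrite (mcomp_complex c2) F2E F1E.
split=> [nat x u y v|H [x u] [y v]]; last by rewrite !sides H.
by have := nat (x, u) (y, v); rewrite !sides => -[].
Qed.

(** Naturality at [(x, 0), (0, v)] and at [(0, u), (y, 0)] gives the two laws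
    of [f2] on boundaries; conversely these two, at [x + d u] and [v] and at [u]
    and [y], add up to naturality at an arbitrary pair of morphisms. *)
Lemma zhom_arrow_natural_zinfE :
  zhom_arrow F F2 /\ zhom_natural F F2 <-> zinf_hom_l2 f0 f1 f2.
Proof.
split=> [[arr nat]|[H1 H2 H3]].
  have N := (zhom_natural_zinfE arr).1 nat.
  split=> [|x v|u y]; first exact: (zhom_arrow_zinfE.1 arr).
  - have := N x 0 0 v.
    rewrite !(linear0r, linear0l, linear0, addr0, add0r) => <-.
    by rewrite addrK.
  - have := N 0 u y 0.
    rewrite !(linear0r, linear0l, linear0, addr0, add0r) => <-.
    by rewrite addrK.
have arr := zhom_arrow_zinfE.2 H1.
split=> //; apply/(zhom_natural_zinfE arr) => x u y v.
have E2 := H2 (x + d u) v; have E3 := H3 u y.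
rewrite linDr -E2 linDl -E3 (linD f1); zmod.
Qed.

(** In the additive form of the coherence condition all identities have a zero
    second component, and the first components agree term by term. *)
Lemma zhom_coherent_zinfE : zhom_arrow F F2 ->
  zhom_coherent F F2 <-> zinf_hom_l3 f0 f1 f2.
Proof.
move=> arr.
have sides x y z :
  (F1 F (zJ x y z) + F2 (x ** y) z + F2 x y *** idm (F0 F z)
      + idm (F0 F x ** F0 F (y ** z)) + idm (F0 F x ** F0 F (z ** y))
      + idm (F0 F x ** (F0 F y ** F0 F z)) + idm (F0 F x ** (F0 F z ** F0 F y))
    = F2 x (y ** z) + F2 x (z ** y)
      + idm (F0 F x) *** F2 y z + idm (F0 F x) *** F2 z y
      + zJ (F0 F x) (F0 F y) (F0 F z)
      + idm (F0 F ((x ** y) ** z)) + idm (F0 F (x ** y) ** F0 F z)) <->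
  f1 (l3 x y z) + f2 (l200 x y) z + l210 (f2 x y) (f0 z)
    = f2 x (l200 y z) + f2 x (l200 z y)
      + l201 (f0 x) (f2 y z) + l201 (f0 x) (f2 z y)
      + l3 (f0 x) (f0 y) (f0 z).
  have mul_l a b c : idm (F0 F a) *** F2 b c =
      (l200 (f0 a) (l200 (f0 b) (f0 c)), l201 (f0 a) (f2 b c)) :> mor Z'.
    by rewrite F2E; apply: zinf_mul_idml.
  have mul_r a b c : F2 a b *** idm (F0 F c) =
      (l200 (l200 (f0 a) (f0 b)) (f0 c), l210 (f2 a b) (f0 c)) :> mor Z'.
    by rewrite F2E; apply: zinf_mul_idmr.
  have J_l : F1 F (zJ x y z) = (f0 (l200 (l200 x y) z), f1 (l3 x y z)) :> mor Z'.
    exact: F1E.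
  rewrite !mul_l mul_r J_l !F2E; split=> [/(congr1 snd)|E].
    by rewrite /= !addr0.
  congr (_, _); last by rewrite /= !addr0.
  by rewrite /= /zinf_zmul0; zmod.
split.
  move/(zhom_coherentE arr) => H x y z; have /sides E := H x y z.
  by rewrite !linDr; apply: (zmod_from E); zmod.
move=> H; apply/(zhom_coherentE arr) => x y z; apply/sides.
have := H x y z; rewrite !linDr => E.
by apply: (zmod_from E); zmod.
Qed.
End HomComponents.

(** * The functor from 2-term Z-infinity-algebras to Zinbiel 2-algebras *)

Section ZinbielHomOfZinf.
Variables (K : fieldType) (V V' : zinf2Term K) (f : zinf2Hom V V').
Local Notation Z := (zinbiel_of_zinf V).
Local Notation Z' := (zinbiel_of_zinf V').

Definition zinf_F1 (u : mor Z) : mor Z' := (f0 f u.1, f1 f u.2).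
Fact zinf_F1_linear : linear zinf_F1.
Proof. by move=> a u v; congr (_, _); rewrite linearP. Qed.
HB.instance Definition _ :=
  GRing.isLinear.Build K (mor Z) (mor Z') *:%R zinf_F1 zinf_F1_linear.

Fact zinf_F1_src u : src (zinf_F1 u) = f0 f (src u).
Proof. by []. Qed.
Fact zinf_F1_tgt u : tgt (zinf_F1 u) = f0 f (tgt u).
Proof.
change (f0 f u.1 + d (f1 f u.2) = f0 f (u.1 + d u.2)).
by rewrite linD f0_d.
Qed.
Fact zinf_F1_idm (x : ob Z) : zinf_F1 (idm x) = idm (f0 f x : ob Z').
Proof. by congr (_, _); rewrite /= linear0. Qed.

Definition twoFunctor_of_zinf : twoFunctor Z Z' :=
  @TwoFunctor K Z Z' (f0 f) zinf_F1 zinf_F1_src zinf_F1_tgt zinf_F1_idm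
    (preserves_mcomp (V := Z) (W := Z') (F0 := f0 f) (F1 := zinf_F1)
       zinf_F1_src zinf_F1_tgt zinf_F1_idm).

Definition zinf_F2 (x y : ob Z) : mor Z' := (l200 (f0 f x) (f0 f y), f2 f x y).
Fact zinf_F2_bilinear : bilinear_for *:%R *:%R zinf_F2.
Proof.
split=> x a u v; rewrite /zinf_F2; congr (_, _); rewrite ?(linearP (f0 f)).
- exact: linearPl.
- exact: linearPl.
- exact: linearPr.
- exact: linearPr.
Qed.
HB.instance Definition _ :=
  bilinear_isBilinear.Build K (ob Z) (ob Z) (mor Z') *:%R *:%R zinf_F2
    zinf_F2_bilinear.

Let F1E x h : F1 twoFunctor_of_zinf (x, h) = (f0 f x, f1 f h) :> mor Z'.
Proof. by []. Qed.
Let F2E x y : zinf_F2 x y = (l200 (f0 f x) (f0 f y), f2 f x y) :> mor Z'.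
Proof. by []. Qed.

Let arrow_natural :=
  (zhom_arrow_natural_zinfE (F := twoFunctor_of_zinf) F1E F2E).2 (f_l2 f).

Definition zinbiel2Hom_of_zinf : zinbiel2Hom Z Z' :=
  @Zinbiel2Hom K Z Z' twoFunctor_of_zinf zinf_F2
    arrow_natural.1 arrow_natural.2
    ((zhom_coherent_zinfE (F := twoFunctor_of_zinf) F1E F2E arrow_natural.1).2
       (f_l3 f)).

End ZinbielHomOfZinf.

Section TheFunctor.
Variable K : fieldType.

Fact zinbiel2Hom_of_zinf_id (V : zinf2Term K) :
  zinbiel2Hom_of_zinf (zinf2Hom_id V) = zinbiel2Hom_id (zinbiel_of_zinf V).
Proof. by apply: zinbiel2Hom_ext => // -[]. Qed.

Fact zinbiel2Hom_of_zinf_comp (V V' V'' : zinf2Term K)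
    (g : zinf2Hom V' V'') (f : zinf2Hom V V') :
  zinbiel2Hom_of_zinf (zinf2Hom_comp g f) =
  zinbiel2Hom_comp (zinbiel2Hom_of_zinf g) (zinbiel2Hom_of_zinf f).
Proof.
apply: zinbiel2Hom_ext => // x y.
change (zinf_F2 (zinf2Hom_comp g f) x y =
  zinf_F1 g (zinf_F2 f x y) \oc zinf_F2 g (f0 f x) (f0 f y)).
have gf := zhom_comp_composable
  (zinbiel2Hom_of_zinf g) (zinbiel2Hom_of_zinf f) x y.
by rewrite (mcomp_complex gf); congr (_, _); apply: addrC.
Qed.

Definition zinf_to_zinbiel : functor (TwoTermZinf K) (Z2Alg K) :=
  @Functor (TwoTermZinf K) (Z2Alg K) (@zinbiel_of_zinf K)
    (@zinbiel2Hom_of_zinf K) zinbiel2Hom_of_zinf_id zinbiel2Hom_of_zinf_comp.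

Lemma zinf_to_zinbiel_faithful (V V' : TwoTermZinf K) (f g : hom V V') :
  fhom zinf_to_zinbiel f = fhom zinf_to_zinbiel g -> f = g.
Proof.
have ext (F G : zinbiel2Hom (zinbiel_of_zinf V) (zinbiel_of_zinf V')) :
    F = G -> [/\ F0 F =1 F0 G, F1 F =1 F1 G & F2 F =2 F2 G] by move=> ->.
case/ext => E0 E1 E2; apply: zinf2Hom_ext => [|h|x y]; first exact: E0.
- exact: (congr1 snd (E1 (0, h))).
- exact: (congr1 snd (E2 x y)).
Qed.

End TheFunctor.

(** * Fullness *)

Section Full.
Variables (K : fieldType) (V V' : zinf2Term K).
Local Notation Z := (zinbiel_of_zinf V).
Local Notation Z' := (zinbiel_of_zinf V').
Variable F : zinbiel2Hom Z Z'.

Definition zhom_f1 (h : V1 V) : V1 V' := (F1 F (0, h)).2.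
Fact zhom_f1_linear : linear zhom_f1.
Proof.
move=> a u v; rewrite /zhom_f1.
have -> : (0, a *: u + v) = a *: (0, u) + (0, v) :> mor Z.
  by congr (_, _); rewrite /= scaler0 addr0.
by rewrite linearP.
Qed.
HB.instance Definition _ :=
  GRing.isLinear.Build K (V1 V) (V1 V') *:%R zhom_f1 zhom_f1_linear.

Definition zhom_f2 (x y : V0 V) : V1 V' := (F2 F x y).2.
Fact zhom_f2_bilinear : bilinear_for *:%R *:%R zhom_f2.
Proof.
by split=> x a u v; rewrite /zhom_f2; [rewrite linearPl|rewrite linearPr].
Qed.
HB.instance Definition _ :=
  bilinear_isBilinear.Build K (V0 V) (V0 V) (V1 V') *:%R *:%R zhom_f2
    zhom_f2_bilinear.

(** [F] respects identities, hence the decomposition [(x, h) = 1_x + (0, h)],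
    and sources, hence the kernel of [src]. *)
Lemma zhom_F1E (x : V0 V) (h : V1 V) :
  F1 F (x, h) = (F0 F x, zhom_f1 h) :> mor Z'.
Proof.
have -> : (x, h) = idm (x : ob Z) + (0, h) :> mor Z.
  by congr (_, _); rewrite /= ?addr0 ?add0r.
rewrite linD F1_idm.
have sF : src (F1 F (0, h)) = 0 by rewrite src_F1 linear0.
have -> : F1 F (0, h) = (0, zhom_f1 h) :> mor Z'.
  by rewrite /zhom_f1 -sF; case: (F1 F _).
by congr (_, _); rewrite /= ?addr0 ?add0r.
Qed.

(** The source of [F2 F x y] is imposed; only its arrow part is free. *)
Lemma zhom_F2E (x y : V0 V) :
  F2 F x y = (l200 (F0 F x) (F0 F y), zhom_f2 x y) :> mor Z'.
Proof.
have sF := src_F2 F x y; rewrite -[l200 _ _]sF /zhom_f2.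
by case: (F2 F x y).
Qed.

Fact zhom_f0_d h : F0 F (d h) = d (zhom_f1 h) :> V0 V'.
Proof.
have := tgt_F1 F (0, h); rewrite zhom_F1E.
change (F0 F 0 + d (zhom_f1 h) = F0 F (0 + d h) -> F0 F (d h) = d (zhom_f1 h)).
by rewrite linear0 !add0r => ->.
Qed.

Definition zinf2Hom_of_zhom : zinf2Hom V V' :=
  @Zinf2Hom K V V' (F0 F) zhom_f1 zhom_f2 zhom_f0_d
    ((zhom_arrow_natural_zinfE zhom_F1E zhom_F2E).1
       (conj (zhomF2_arrow F) (zhomF2_natural F)))
    ((zhom_coherent_zinfE zhom_F1E zhom_F2E (zhomF2_arrow F)).1
       (zhomF2_coherent F)).

Lemma zinf2Hom_of_zhomK : zinbiel2Hom_of_zinf zinf2Hom_of_zhom = F.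
Proof.
apply: zinbiel2Hom_ext => [//|[x h]|x y].
  by rewrite zhom_F1E.
by rewrite zhom_F2E.
Qed.

End Full.

(** * The 2-term Z-infinity-algebra of a Zinbiel 2-algebra *)

Section Kernel.
Variables (K : fieldType) (U W : lmodType K) (f : {linear U -> W}).

Definition ker_pred : {pred U} := [pred u | f u == 0].

Fact ker_submod_closed : submod_closed ker_pred.
Proof.
split=> [|a u v]; rewrite !inE ?linear0 // => /eqP fu /eqP fv.
by rewrite linearP fu fv scaler0 addr0.
Qed.
HB.instance Definition _ :=
  GRing.isSubmodClosed.Build K U ker_pred ker_submod_closed.

Record ker := Ker { ker_val :> U; _ : ker_val \in ker_pred }.

HB.instance Definition _ := [isSub for ker_val].
HB.instance Definition _ := [Choice of ker by <:].
HB.instance Definition _ := [SubChoice_isSubLmodule of ker by <:].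

Lemma kerP (k : ker) : f (val k) = 0.
Proof. exact/eqP/(valP k). Qed.

Lemma ker_valD (h k : ker) : val (h + k) = val h + val k.
Proof. by []. Qed.

Lemma ker_valB (h k : ker) : val (h - k) = val h - val k.
Proof. by []. Qed.

Lemma ker_valP a (h k : ker) : val (a *: h + k) = a *: val h + val k.
Proof. by []. Qed.

Lemma in_ker u : f u = 0 -> u \in ker_pred.
Proof. by move=> fu; rewrite inE fu. Qed.

End Kernel.

Section ZinfOfZinbiel.
Variables (K : fieldType) (Z : zinbiel2Alg K).

(** The degree 1 part of the 2-term algebra, with the target map as
    differential. *)
Definition core : lmodType K := ker (@src K Z).

Definition core_d (h : core) : ob Z := tgt (val h).
Fact core_d_linear : linear core_d.
Proof. by move=> a h k; rewrite /core_d !linearP. Qed.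
HB.instance Definition _ :=
  GRing.isLinear.Build K core (ob Z) *:%R core_d core_d_linear.

Fact core_mull_in (x : ob Z) (h : core) :
  idm x *** val h \in ker_pred (@src K Z).
Proof. by apply: in_ker; rewrite src_zmul kerP linear0r. Qed.
Definition core_mull (x : ob Z) (h : core) : core := Ker (core_mull_in x h).
Fact core_mull_bilinear : bilinear_for *:%R *:%R core_mull.
Proof.
split=> x a u v; apply: val_inj; rewrite [RHS]linearP /=.
  by rewrite linearP linearPl.
by rewrite linearPr.
Qed.
HB.instance Definition _ :=
  bilinear_isBilinear.Build K (ob Z) core core *:%R *:%R core_mull
    core_mull_bilinear.

Fact core_mulr_in (h : core) (x : ob Z) :
  val h *** idm x \in ker_pred (@src K Z).
Proof. by apply: in_ker; rewrite src_zmul kerP linear0l. Qed.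
Definition core_mulr (h : core) (x : ob Z) : core := Ker (core_mulr_in h x).
Fact core_mulr_bilinear : bilinear_for *:%R *:%R core_mulr.
Proof.
split=> x a u v; apply: val_inj; rewrite [RHS]linearP /=.
  by rewrite linearPl.
by rewrite linearP linearPr.
Qed.
HB.instance Definition _ :=
  bilinear_isBilinear.Build K core (ob Z) core *:%R *:%R core_mulr
    core_mulr_bilinear.

Definition core_l3 (x y z : ob Z) : core :=
  Ker (in_ker (src_arrow_part (zJ x y z))).

Fact core_l3E x y z : val (core_l3 x y z) = zJ x y z - idm ((x ** y) ** z).
Proof. by rewrite /= /arrow_part src_zJ. Qed.

Fact core_l3_trilinear : trilinear core_l3.
Proof.
have [J1 J2 J3] := zJ_trilinear Z.
split=> u v a x y; apply: val_inj; rewrite ker_valP !core_l3E.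
- by rewrite J1 !linearPl linearP scalerBr opprD addrACA.
- by rewrite J2 linearPr linearPl linearP scalerBr opprD addrACA.
- by rewrite J3 linearPr linearP scalerBr opprD addrACA.
Qed.

(** Interchange, for [h] and [k] in the kernel of [src]: as [h] is the composite
    of [1_(tgt h)] after [h] and [k] that of [k] after [0], the product [h k] is
    [1_(tgt h)] on [k] after [h] on [0], and the latter vanishes. The second
    formula is obtained with the roles exchanged; together they give
    [l2 (d h, k) = l2 (h, d k)]. *)
Lemma core_mulE (h k : core) :
  (val h *** val k = idm (tgt (val h)) *** val k) *
  (val h *** val k = val h *** idm (tgt (val k))).
Proof.
have comp0 (f : mor Z) : src f = 0 -> f \oc 0 = f.
  by move=> f0; rewrite -{2}[f]mcomp_idm f0 linear0.
have src0 (u : core) : src (val u) = tgt (0 : mor Z) by rewrite kerP linear0.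
split.
  have := zmul_comp (src_idm (tgt (val h))) (src0 k).
  rewrite idm_mcomp (comp0 (val k)) ?kerP // linear0r => ->.
  by rewrite comp0 // src_zmul kerP linear0r.
have := zmul_comp (src0 h) (src_idm (tgt (val k))).
rewrite idm_mcomp (comp0 (val h)) ?kerP // linear0l => ->.
by rewrite comp0 // src_zmul kerP linear0l.
Qed.

Fact core_d_l2 : zinf_d_l2 core_d zmul0 core_mull core_mulr.
Proof.
split=> [x h|h x|h k].
- change (tgt (idm x *** val h) = x ** tgt (val h)).
  by rewrite tgt_zmul tgt_idm.
- change (tgt (val h *** idm x) = tgt (val h) ** x).
  by rewrite tgt_zmul tgt_idm.
apply: val_inj.
change (idm (tgt (val h)) *** val k = val h *** idm (tgt (val k))).
by rewrite -!core_mulE.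
Qed.

Fact core_d_l3 : zinf_d_l3 core_d zmul0 core_l3.
Proof.
move=> x y z; change (tgt (val (core_l3 x y z)) =
  x ** (y ** z) + x ** (z ** y) - (x ** y) ** z).
by rewrite core_l3E linB tgt_zJ tgt_idm.
Qed.

Lemma zJ_naturalE (f g h : mor Z) :
  zJ (tgt f) (tgt g) (tgt h) + (f *** g) *** h
    - idm ((tgt f ** tgt g) ** tgt h)
  = f *** (g *** h) + f *** (h *** g) + zJ (src f) (src g) (src h)
    - (idm (src f ** (src g ** src h)) + idm (src f ** (src h ** src g))).
Proof.
have := zJ_natural f g h; rewrite !compE.
- by rewrite !tgt_zmul tgt_zJ linD.
- by rewrite linD !src_zmul tgt_zJ.
- by rewrite src_zJ !tgt_zmul.
Qed.

(** Each law is the naturality of [J] with an element of the kernel in one slot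
    and identities in the others: the source of that element is [0], where [J]
    vanishes. *)
Fact core_l3_d : zinf_l3_d core_d zmul0 core_mull core_mulr core_l3.
Proof.
have [J1 J2 J3] := zJ_trilinear Z.
have J0l (y z : ob Z) : zJ 0 y z = 0 := linear_fun0 (J1 y z).
have J0m (x z : ob Z) : zJ x 0 z = 0 := linear_fun0 (J2 x z).
have J0r (x y : ob Z) : zJ x y 0 = 0 := linear_fun0 (J3 x y).
split=> [x y h|x h z|h y z]; apply: val_inj.
- change (val (core_l3 x y (tgt (val h))) = idm x *** (idm y *** val h)
    + idm x *** (val h *** idm y) - idm (x ** y) *** val h).
  have := zJ_naturalE (idm x) (idm y) (val h).
  rewrite core_l3E !src_idm !tgt_idm kerP J0r !(linear0r, linear0l, linear0).
  rewrite zmul_idm !addr0 subr0 => <-; zmod.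
- change (val (core_l3 x (tgt (val h)) z) = idm x *** (val h *** idm z)
    + idm x *** (idm z *** val h) - (idm x *** val h) *** idm z).
  have := zJ_naturalE (idm x) (val h) (idm z).
  rewrite core_l3E !src_idm !tgt_idm kerP J0m !(linear0r, linear0l, linear0).
  rewrite !addr0 subr0 => <-; zmod.
- change (val (core_l3 (tgt (val h)) y z) = val h *** idm (y ** z)
    + val h *** idm (z ** y) - (val h *** idm y) *** idm z).
  have := zJ_naturalE (val h) (idm y) (idm z).
  rewrite core_l3E !src_idm !tgt_idm kerP J0l !(linear0r, linear0l, linear0).
  rewrite !zmul_idm !addr0 subr0 => <-; zmod.
Qed.

Fact core_l3_coherent : zinf_coherent zmul0 core_mull core_mulr core_l3.
Proof.
move=> x y z t; apply: val_inj.
have [_ L2 L3] := core_l3_trilinear.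
have Dy a b b' c : core_l3 a (b + b') c = core_l3 a b c + core_l3 a b' c.
  exact: (linear_fun_add (L2 _ _)).
have Dz a b c c' : core_l3 a b (c + c') = core_l3 a b c + core_l3 a b c'.
  exact: (linear_fun_add (L3 _ _)).
rewrite Dy Dz !(ker_valB, ker_valD).
change (let j (x y z : ob Z) := arrow_part (zJ x y z) in
  idm x *** j y z t + idm x *** j z y t
  + (j x (y ** z) t + j x (z ** y) t) + j x y z *** idm t
  - idm x *** j z t y - idm x *** j t z y
  - (j x y (z ** t) + j x y (t ** z)) - j (x ** y) z t = 0) => j.
have E := (zinbielator_coherentE (zmul_functor Z) (@zJ_arrow K Z)).1
  (@zJ_coherent K Z) x y z t.
by apply: (zmod_from E); rewrite /j; zmod.
Qed.

Definition zinf_of_zinbiel : zinf2Term K :=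
  @Zinf2Term K (ob Z) core core_d zmul0 core_mull core_mulr core_l3
    core_l3_trilinear core_d_l2 core_d_l3 core_l3_d core_l3_coherent.

End ZinfOfZinbiel.

(** * Essential surjectivity *)

(** Compatibility of a functor with products and Zinbielators on the nose, which
    makes it a homomorphism with identities for [F2]. *)
Definition strict (K : fieldType) (Z Z' : zinbiel2Alg K) (F : twoFunctor Z Z') :=
  [/\ forall x y, F0 F (x ** y) = F0 F x ** F0 F y,
      forall f g, F1 F (f *** g) = F1 F f *** F1 F g
    & forall x y z, F1 F (zJ x y z) = zJ (F0 F x) (F0 F y) (F0 F z)].

Section StrictHom.
Variables (K : fieldType) (Z Z' : zinbiel2Alg K) (F : twoFunctor Z Z').
Hypothesis strF : strict F.

Definition strict_F2 (x y : ob Z) : mor Z' := idm (F0 F x ** F0 F y).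
Fact strict_F2_bilinear : bilinear_for *:%R *:%R strict_F2.
Proof.
split=> x a u v; rewrite /strict_F2 linearP.
  by rewrite linearPl linearP.
by rewrite linearPr linearP.
Qed.
HB.instance Definition _ :=
  bilinear_isBilinear.Build K (ob Z) (ob Z) (mor Z') *:%R *:%R strict_F2
    strict_F2_bilinear.

Fact strict_arrow : zhom_arrow F strict_F2.
Proof. by have [F0M _ _] := strF; move=> x y; rewrite F0M; apply: arrow_idm. Qed.

Fact strict_natural : zhom_natural F strict_F2.
Proof.
have [F0M F1M _] := strF; move=> f g; rewrite /strict_F2 F1M.
rewrite -!tgt_F1 -!src_F1 -tgt_zmul -src_zmul.
by rewrite idm_mcomp mcomp_idm.
Qed.

Fact strict_coherent : zhom_coherent F strict_F2.
Proof.
have [F0M _ F1J] := strF; apply/(zhom_coherentE strict_arrow) => x y z.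
by rewrite /strict_F2 F1J !F0M !zmul_idm; zmod.
Qed.

Definition strict_hom : zinbiel2Hom Z Z' :=
  @Zinbiel2Hom K Z Z' F strict_F2 strict_arrow strict_natural strict_coherent.

End StrictHom.

(** The inverse functor is strict as well, and composites of strict
    homomorphisms have identities for [F2]; so an isomorphism of underlying
    2-vector spaces that is strict is an isomorphism of Zinbiel 2-algebras. *)
Lemma strict_iso (K : fieldType) (Z Z' : Z2Alg K)
    (F : twoFunctor Z Z') (G : twoFunctor Z' Z) (strF : strict F) :
  cancel (F0 F) (F0 G) -> cancel (F0 G) (F0 F) ->
  cancel (F1 F) (F1 G) -> cancel (F1 G) (F1 F) ->
  cat_iso (strict_hom strF : hom Z Z').
Proof.
move=> FK0 GK0 FK1 GK1; have [F0M F1M F1J] := strF.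
have strG : strict G.
  split=> [x y|f g|x y z].
  - by apply: (can_inj FK0); rewrite F0M !GK0.
  - by apply: (can_inj FK1); rewrite F1M !GK1.
  - by apply: (can_inj FK1); rewrite F1J !GK0 GK1.
exists (strict_hom strG).
split; apply: zinbiel2Hom_ext => // x y.
- have [G0M _ _] := strG.
  change (F1 G (idm (F0 F x ** F0 F y)) \oc idm (F0 G (F0 F x) ** F0 G (F0 F y))
    = idm (x ** y)).
  rewrite F1_idm G0M -[X in _ \oc idm X]src_idm mcomp_idm.
  by rewrite !FK0.
- change (F1 F (idm (F0 G x ** F0 G y)) \oc idm (F0 F (F0 G x) ** F0 F (F0 G y))
    = idm (x ** y)).
  rewrite F1_idm F0M -[X in _ \oc idm X]src_idm mcomp_idm.
  by rewrite !GK0.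
Qed.

Section Counit.
Variables (K : fieldType) (Z : zinbiel2Alg K).
Local Notation Z' := (zinbiel_of_zinf (zinf_of_zinbiel Z)).

(** The splitting of a morphism into an identity and a kernel element, read
    backwards; [decomp1] below is its inverse. *)
Definition counit1 (u : mor Z') : mor Z := idm u.1 + val (u.2 : core Z).
Fact counit1_linear : linear counit1.
Proof.
move=> a u v; rewrite /counit1.
by rewrite [idm _]linearP scalerDr addrACA.
Qed.
HB.instance Definition _ :=
  GRing.isLinear.Build K (mor Z') (mor Z) *:%R counit1 counit1_linear.

Fact counit1_src u : src (counit1 u) = idfun (src u).
Proof. by rewrite linD src_idm kerP addr0. Qed.
Fact counit1_tgt u : tgt (counit1 u) = idfun (tgt u).
Proof. by rewrite linD tgt_idm. Qed.
Fact counit1_idm (x : ob Z') : counit1 (idm x) = idm (idfun x : ob Z).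
Proof. exact: addr0. Qed.

Definition counit : twoFunctor Z' Z :=
  @TwoFunctor K Z' Z idfun counit1 counit1_src counit1_tgt counit1_idm
    (preserves_mcomp (V := Z') (W := Z) (F0 := idfun) (F1 := counit1)
       counit1_src counit1_tgt counit1_idm).

Definition decomp1 (f : mor Z) : mor Z' :=
  (src f, Ker (in_ker (src_arrow_part f)) : core Z).

Fact decomp1K : cancel decomp1 counit1.
Proof. by move=> f; rewrite /counit1 /= /arrow_part addrC subrK. Qed.

Fact counit1K : cancel counit1 decomp1.
Proof.
move=> u; have s : src (counit1 u) = u.1 by rewrite counit1_src.
case: u s => x h s; congr (_, _); first exact: s.
by apply: val_inj; rewrite /= /arrow_part s /counit1 /=; zmod.
Qed.

Fact decomp1_linear : linear decomp1.
Proof.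
move=> a f g; apply: (can_inj counit1K); rewrite decomp1K counit1_linear.
by rewrite !decomp1K.
Qed.
HB.instance Definition _ :=
  GRing.isLinear.Build K (mor Z) (mor Z') *:%R decomp1 decomp1_linear.

Fact decomp1_src f : src (decomp1 f) = idfun (src f).
Proof. by []. Qed.
Fact decomp1_tgt f : tgt (decomp1 f) = idfun (tgt f).
Proof. by rewrite -[in RHS](decomp1K f) counit1_tgt. Qed.
Fact decomp1_idm (x : ob Z) : decomp1 (idm x) = idm (idfun x : ob Z').
Proof. by apply: (can_inj counit1K); rewrite decomp1K counit1_idm. Qed.

Definition decomp : twoFunctor Z Z' :=
  @TwoFunctor K Z Z' idfun decomp1 decomp1_src decomp1_tgt decomp1_idm
    (preserves_mcomp (V := Z) (W := Z') (F0 := idfun) (F1 := decomp1)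
       decomp1_src decomp1_tgt decomp1_idm).

(** Expanding [(1_x + h) (1_y + k)], the term [h k] equals [1_(d h)] on [k], as
    prescribed by the product of the 2-algebra of a 2-term algebra. *)
Fact counit_strict : strict counit.
Proof.
split=> [//|[x h] [y k]|x y z].
- change (idm (x ** y) + (idm (x + tgt (val h)) *** val k + val h *** idm y) =
    (idm x + val h) *** (idm y + val k)).
  by rewrite linD !linDl !linDr zmul_idm -core_mulE; zmod.
- rewrite -[LHS]/(idm (((x : ob Z) ** y) ** z)
    + val (core_l3 (x : ob Z) y z)).
  by rewrite core_l3E addrC subrK.
Qed.

End Counit.

Lemma zinf_to_zinbiel_ess_surj (K : fieldType) (Z : Z2Alg K) :
  exists (V : TwoTermZinf K) (e : hom (zinf_to_zinbiel K V) Z), cat_iso e.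
Proof.
exists (zinf_of_zinbiel Z), (strict_hom (counit_strict Z)).
apply: (strict_iso (G := decomp Z)) => //.
- exact: counit1K.
- exact: decomp1K.
Qed.

(** * The equivalence *)

Theorem theorem3p5 (K : fieldType) :
  equivalent_categories (TwoTermZinf K) (Z2Alg K).
Proof.
apply: (equivalence_of_fully_faithful (F := zinf_to_zinbiel K)).
- exact: zinf_to_zinbiel_faithful.
- by move=> V V' F; exists (zinf2Hom_of_zhom F); apply: zinf2Hom_of_zhomK.
- exact: zinf_to_zinbiel_ess_surj.
Qed.
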